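(* Let $R$ be a ring and let $(\mathcal D,\prec)$ be an AEC of roots of Ext over $R$, with Löwenheim–Skolem number $\rho=\mathrm{LS}(\mathcal D)$. Then Shelah's Categoricity Conjecture holds for $(\mathcal D,\prec)$: if $\mathcal D$ is $\lambda$-categorical for some cardinal $\lambda\geq \beth_{(2^\rho)^+}$, then $\mathcal D$ is $\mu$-categorical for every cardinal $\mu\geq\beth_{(2^\rho)^+}$.
   Context: Modules are unitary right $R$-modules. A class of modules $\mathcal D$ is $\lambda$-categorical ($\lambda$ an infinite cardinal) if $\mathcal D$ contains a module of cardinality $\lambda$ and all modules in $\mathcal D$ of cardinality $\lambda$ are isomorphic. An abstract elementary class (AEC) is a pair $(\mathcal A,\prec)$ where $\mathcal A$ is a class of structures in a fixed vocabulary $\tau$ and $\prec$ is a partial order on $\mathcal A$, both closed under isomorphisms, such that: (A1) $A\prec B$ implies $A$ is a substructure of $B$; (A2) for every continuous $\prec$-increasing chain $(A_i\mid i<\delta)$ in $\mathcal A$ (i.e. $A_i\prec A_{i+1}$ and $A_i=\bigcup_{j<i}A_j$ for limit $i$), $\bigcup_i A_i\in\mathcal A$, $A_j\prec\bigcup_iA_i$ for all $j$, and if $A_i\prec M\in\mathcal A$ for all $i$ then $\bigcup_iA_i\prec M$; (A3) if $A,B,C\in\mathcal A$, $A\prec C$, $B\prec C$ and $A$ is a substructure of $B$, then $A\prec B$; (A4) there is a cardinal $\kappa$ such that for every substructure $A$ of $B\in\mathcal A$ there is $A'\in\mathcal A$ containing $A$ with $A'\prec B$ and $|A'|\le |A|+\kappa$.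 The least such infinite $\kappa\ge\mathrm{card}\,\tau$ is the Löwenheim–Skolem number $\mathrm{LS}(\mathcal A)$. For a class $\mathcal C$ of modules let ${}^{\perp_\infty}\mathcal C=\{M\mid \mathrm{Ext}^i_R(M,C)=0\text{ for all }i\ge1, C\in\mathcal C\}$; for $\mathcal A={}^{\perp_\infty}\mathcal C$ define $A\prec B$ iff $A$ is a submodule of $B$ and $A,B,B/A\in\mathcal A$. An AEC of roots of Ext is a pair $(\mathcal A,\prec)$ of this form which is an AEC. The beth function: $\beth_0=\aleph_0$, $\beth_{\alpha+1}=2^{\beth_\alpha}$, $\beth_\alpha=\sup_{\beta<\alpha}\beth_\beta$ for limit $\alpha$. *)

(* Defs.v *)
From HB Require Import structures.
From mathcomp Require Import all_boot all_order all_algebra.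
From mathcomp Require Import generic_quotient ring_quotient.
From mathcomp Require Import boolp classical_sets functions cardinality wochoice.

Set Implicit Arguments.
Unset Strict Implicit.
Unset Printing Implicit Defensive.

Import GRing.Theory.

Local Open Scope ring_scope.
Local Open Scope quotient_scope.
Local Open Scope classical_set_scope.
Local Open Scope card_scope.

Section SubQuot.
Variables (K : pzRingType) (V : lmodType K) (A : submodClosed V).

Definition subm : Type := {x : V | x \in A}.

HB.instance Definition _ := SubType.copy subm {x : V | x \in A}.
HB.instance Definition _ := [Choice of subm by <:].
HB.instance Definition _ := [SubChoice_isSubLmodule of subm by <:].

Let oppA : oppr_closed A.
Proof. by move=> x xA; rewrite -scaleN1r rpredZ. Qed.

(* [submodClosed] does not inherit from [zmodClosed], on which the quotients
   of the library are based. *)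
Definition submod_zmod : zmodClosed V :=
  HB.pack (A : {pred V}) (GRing.isOppClosed.Build V A oppA)
    A.

Definition quotm : Type := Quotient.quot submod_zmod.

HB.instance Definition _ := GRing.Zmodule.on quotm.

Let q (x : V) : Quotient.quot submod_zmod := \pi x.

Let q_eqP (x y : V) : q x = q y <-> x - y \in A.
Proof.
have -> : (x - y \in A) = (q x == q y) := Quotient.idealrBE submod_zmod x y.
by split=> /eqP.
Qed.

Let qD (x y : V) : q (x + y) = q x + q y.
Proof. exact: raddfD. Qed.

Definition quotm_scale (a : K) (x : quotm) : quotm :=
  q (a *: repr (x : Quotient.quot submod_zmod)).

Let scale_q a x : quotm_scale a (q x) = q (a *: x).
Proof.
by apply/q_eqP; rewrite -scalerBr rpredZ //; apply/q_eqP; rewrite /q reprK.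
Qed.

Let qind (P : quotm -> Prop) : (forall x, P (q x)) -> forall x, P x.
Proof. by move=> h x; rewrite -[x](reprK (x : Quotient.quot submod_zmod)). Qed.

Let scaleA a b (x : quotm) :
  quotm_scale a (quotm_scale b x) = quotm_scale (a * b) x.
Proof. by elim/qind: x => x; rewrite !scale_q scalerA. Qed.

Let scale1 : left_id 1 quotm_scale.
Proof. by elim/qind=> x; rewrite scale_q scale1r. Qed.

Let scaleDr : right_distributive quotm_scale +%R.
Proof.
move=> a; elim/qind=> x; elim/qind=> y.
by rewrite -[q x + q y]qD !scale_q scalerDr qD.
Qed.

Let scaleDl (x : quotm) : {morph quotm_scale^~ x : a b / a + b}.
Proof.
by elim/qind: x => x a b; rewrite !scale_q scalerDl qD.
Qed.

HB.instance Definition _ :=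
  GRing.Zmodule_isLmodule.Build K quotm scaleA scale1 scaleDr scaleDl.

Definition quotm_pi : V -> quotm := q.

Let quotm_pi_zmod : zmod_morphism quotm_pi.
Proof.
by move=> x y; exact: (raddfB (\pi : V -> Quotient.quot submod_zmod)).
Qed.

Let quotm_pi_scale : scalable quotm_pi.
Proof. by move=> a x; exact: esym (scale_q a x). Qed.

HB.instance Definition _ :=
  GRing.isZmodMorphism.Build V quotm quotm_pi quotm_pi_zmod.
HB.instance Definition _ :=
  GRing.isScalable.Build K V quotm *:%R quotm_pi quotm_pi_scale.

Lemma quotm_pi_surj (y : quotm) : exists x, quotm_pi x = y.
Proof. by elim/qind: y => x; exists x. Qed.

Lemma quotm_pi_eq0 (x : V) : quotm_pi x = 0 <-> x \in A.
Proof. by rewrite -(raddf0 quotm_pi) q_eqP subr0. Qed.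

End SubQuot.

Arguments quotm_pi {K V} A.

(* [relsub B A]: the submodule A (more precisely, A intersected with B) of the
   ambient module V, viewed as a submodule of the module B. *)
Section RelSub.
Variables (K : pzRingType) (V : lmodType K) (B A : submodClosed V).

Definition relsub : {pred subm B} := fun x => val x \in A.

Let relsub_closed : submod_closed relsub.
Proof.
have relE x : (x \in relsub) = (val x \in A) by [].
split=> [|a x y]; rewrite !relE ?raddf0 ?rpred0 //.
by move=> xA yA; rewrite linearP rpredD ?rpredZ.
Qed.

HB.instance Definition _ :=
  GRing.isSubmodClosed.Build K (subm B) relsub relsub_closed.

End RelSub.

Arguments relsub {K V} B A.

(* A cardinal is a type up to equipotence. The universe is that of the carriers
   of modules, so that cardinals are exactly the possible sizes of a module. *)
Definition cardinal := Type@{GRing.Lmodule.axioms_.u0}.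

Definition cle (K L : cardinal) : Prop := [set: K] #<= [set: L].
Definition ceq (K L : cardinal) : Prop := [set: K] #= [set: L].
Definition cinfinite (K : cardinal) : Prop := infinite_set [set: K].

Definition cpow2 (K : cardinal) : cardinal := K -> bool.

Definition is_csup (W : cardinal) (P : set W) (b : W -> cardinal)
    (T : cardinal) : Prop :=
  (forall y, P y -> cle (b y) T) /\
  (forall S : cardinal, (forall y, P y -> cle (b y) S) -> cle T S).

(* An ordinal is represented by a well-ordering [le] of a type [W]; [wlt] is the
   associated strict order. An element [x] of [W] stands for the ordinal that is
   the order type of its set of predecessors [wbelow le x]. *)
Definition wlt (W : Type) (le : rel W) (x y : W) : Prop := ~~ le y x.
Definition wbelow (W : Type) (le : rel W) (x : W) : set W :=
  [set y | wlt le y x].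

Definition is_greatest (W : Type) (le : rel W) (P : set W) (y : W) : Prop :=
  P y /\ forall z, P z -> le z y.

(* [x] is the successor of [y]; below, 0 does not count as a limit. *)
Definition is_succ (W : Type) (le : rel W) (y x : W) : Prop :=
  is_greatest le (wbelow le x) y.
Definition is_limit (W : Type) (le : rel W) (x : W) : Prop :=
  wbelow le x !=set0 /\ ~ exists y, is_succ le y x.

(* For [P] an initial segment of [W], of order type alpha, the value at alpha of
   the beth function, [b] being its restriction to the ordinals below alpha. *)
Definition beth_eqn (W : cardinal) (le : rel W) (P : set W)
    (b : W -> cardinal) (T : cardinal) : Prop :=
  [/\ P = set0 -> ceq T nat,
      forall y, is_greatest le P y -> ceq T (cpow2 (b y)) &
      P !=set0 -> (~ exists y, is_greatest le P y) -> is_csup P b T].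

(* [T] is beth_alpha, for alpha the order type of [le] *)
Definition is_beth (W : cardinal) (le : rel W) (T : cardinal) : Prop :=
  exists b : W -> cardinal,
    (forall x, beth_eqn le (wbelow le x) b (b x)) /\ beth_eqn le setT b T.

(* [le] has order type K^+, the least ordinal of cardinality greater than K *)
Definition is_succ_cardinal (K W : cardinal) (le : rel W) : Prop :=
  [/\ well_order le,
      ~ cle W K &
      forall x, wbelow le x #<= [set: K]].

(* Right R-modules are left modules over the opposite ring. *)
Notation rmodType R := (lmodType R^c).

Definition modclass (R : pzRingType) := rmodType R -> Prop.

Definition is_iso (R : pzRingType) (M N : rmodType R) (f : {linear M -> N}) :=
  bijective f.

Definition isomorphic (R : pzRingType) (M N : rmodType R) : Prop :=
  exists f : {linear M -> N}, is_iso f.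

Definition categorical (R : pzRingType) (D : modclass R) (l : cardinal) : Prop :=
  (exists M, D M /\ ceq M l) /\
  (forall M N, D M -> D N -> ceq M l -> ceq N l -> isomorphic M N).

Definition projective (R : pzRingType) (P : rmodType R) : Prop :=
  forall (M N : rmodType R) (g : {linear M -> N}) (f : {linear P -> N}),
    (forall y, exists x, g x = y) ->
    exists h : {linear P -> M}, forall x, g (h x) = f x.

Record proj_resolution (R : pzRingType) (M : rmodType R) := ProjResolution {
  res_obj : nat -> rmodType R;
  res_d : forall n, {linear res_obj n.+1 -> res_obj n};
  res_aug : {linear res_obj 0 -> M};
  res_projective : forall n, projective (res_obj n);
  res_aug_surj : forall y, exists x, res_aug x = y;
  res_exact0 : forall x, res_aug x = 0 <-> exists y, res_d 0 y = x;
  res_exact : forall n x, res_d n x = 0 <-> exists y, res_d n.+1 y = x }.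

(* H^i of the complex Hom(P, C) is 0. *)
Definition cohomology_vanishes (R : pzRingType) (M C : rmodType R)
    (P : proj_resolution M) (i : nat) : Prop :=
  match i with
  | 0 => forall f : {linear res_obj P 0 -> C},
      (forall x, f (res_d P 0 x) = 0) -> forall x, f x = 0
  | j.+1 => forall f : {linear res_obj P j.+1 -> C},
      (forall x, f (res_d P j.+1 x) = 0) ->
      exists g : {linear res_obj P j -> C}, forall x, f x = g (res_d P j x)
  end.

(* Ext^i(M, C) = 0. The cohomology does not depend on the resolution, which
   exists since every module is a quotient of a free one. *)
Definition Ext_vanishes (R : pzRingType) (i : nat) (M C : rmodType R) : Prop :=
  forall P : proj_resolution M, cohomology_vanishes C P i.

Definition perp_inf (R : pzRingType) (C : modclass R) : modclass R :=
  fun M => forall i N, (1 <= i)%N -> C N -> Ext_vanishes i M N.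

(* [prec M A] stands for "A is a strong submodule of M". That a strong submodule
   is a substructure is part of the typing, which also makes antisymmetry
   automatic; the classes below are thus given in the language of modules. *)
Definition strongrel (R : pzRingType) :=
  forall M : rmodType R, submodClosed M -> Prop.

Definition sub_le (R : pzRingType) (M : rmodType R) (A B : submodClosed M) :=
  forall x, x \in A -> x \in B.

(* "A is a strong submodule of B", for A and B given inside a common module *)
Definition sprec (R : pzRingType) (prec : strongrel R) (M : rmodType R)
    (A B : submodClosed M) : Prop :=
  sub_le A B /\ prec (subm B) (relsub B A).

(* A continuous increasing chain; its members may be taken to be submodules of
   a common module, for instance their union. *)
Definition continuous_chain (R : pzRingType) (D : modclass R)
    (prec : strongrel R) (I : cardinal) (le : rel I) (M : rmodType R)
    (A : I -> submodClosed M) : Prop :=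
  [/\ well_order le,
      forall i, D (subm (A i)),
      forall i j, is_succ le i j -> sprec prec (A i) (A j) &
      forall i, is_limit le i ->
        forall x, x \in A i <-> exists2 j, wlt le j i & x \in A j].

Definition LS_property (R : pzRingType) (D : modclass R) (prec : strongrel R)
    (k : cardinal) : Prop :=
  forall (M : rmodType R) (A : submodClosed M), D M ->
    exists A' : submodClosed M,
      [/\ sub_le A A', D (subm A'), prec M A' & cle (subm A') (subm A + k)%type].

Record is_AEC (R : pzRingType) (D : modclass R) (prec : strongrel R) : Prop := {
  AEC_class_iso : forall M N, isomorphic M N -> D M -> D N;
  AEC_prec_iso : forall (M N : rmodType R) (f : {linear M -> N})
      (A : submodClosed M) (B : submodClosed N),
    is_iso f -> (forall x, x \in A <-> f x \in B) -> prec M A -> prec N B;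
  AEC_prec_class : forall M A, prec M A -> D (subm A) /\ D M;
  AEC_prec_refl : forall (M : rmodType R) (A : submodClosed M),
    D M -> (forall x, x \in A) -> prec M A;
  AEC_prec_trans : forall (M : rmodType R) (A B : submodClosed M),
    sprec prec A B -> prec M B -> prec M A;
  AEC_chain : forall (I : cardinal) (le : rel I) (M : rmodType R)
      (A : I -> submodClosed M) (U : submodClosed M),
    continuous_chain D prec le A ->
    (forall x, x \in U <-> exists i, x \in A i) ->
    [/\ D (subm U),
        forall i, sprec prec (A i) U &
        D M -> (forall i, prec M (A i)) -> prec M U];
  AEC_coherence : forall (M : rmodType R) (A B : submodClosed M),
    D (subm A) -> D (subm B) -> D M ->
    prec M A -> prec M B -> sub_le A B -> sprec prec A B;
  AEC_LS : exists k : cardinal, LS_property D prec k }.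

Inductive mod_symbol (R : pzRingType) :=
  | SymZero | SymOpp | SymAdd | SymScale of R.

Definition LS_admissible (R : pzRingType) (D : modclass R) (prec : strongrel R)
    (k : cardinal) : Prop :=
  [/\ cinfinite k, cle (mod_symbol R) k & LS_property D prec k].

Definition is_LS_number (R : pzRingType) (D : modclass R) (prec : strongrel R)
    (k : cardinal) : Prop :=
  LS_admissible D prec k /\
  forall k' : cardinal, LS_admissible D prec k' -> cle k k'.

Definition ext_prec (R : pzRingType) (D : modclass R) : strongrel R :=
  fun M A => [/\ D (subm A), D M & D (quotm A)].

Definition AEC_of_roots_of_Ext (R : pzRingType) (D : modclass R)
    (prec : strongrel R) : Prop :=
  [/\ exists C : modclass R, forall M, D M <-> perp_inf C M,
      forall M A, prec M A <-> ext_prec D A &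
      is_AEC D prec].

(* Main.v *)
Require Import Defs.
From HB Require Import structures.
From mathcomp Require Import all_boot all_order all_algebra.
From mathcomp Require Import boolp classical_sets functions cardinality wochoice.

(* Let D be lambda-categorical, with lambda above the bound.  The free module F
   of rank lambda lies in D, and D is closed under sums with projective modules,
   so a module N of D with |N| <= lambda satisfies N + F = F and is projective.
   The Loewenheim-Skolem property in quotients M/A and the chain axiom filter
   every M in D with consecutive quotients in D of size <= rho; these are
   projective, so the filtration splits: M is projective, and a direct sum of
   modules V_x in D of size <= rho.
   A nonzero V_x is a generator, since the sum of lambda copies of V_x is F;
   hence 1 = r_1 + ... + r_n with each r_k in the image of a map V_x -> R.  There
   are at most rho such sequences (r_k), so when |M| > rho, all but at most rho
   of the x can be cut into blocks sharing the same sequence, and each block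
   maps onto R.  So M maps onto the free module of rank |M|, which is then a
   direct summand of M, and Eilenberg's swindle shows that M is free.  Finally
   the bound exceeds rho, and a free module is determined by its rank. *)

Set Implicit Arguments.
Unset Strict Implicit.
Unset Printing Implicit Defensive.

Import GRing.Theory.

Local Open Scope ring_scope.
Local Open Scope classical_set_scope.
Local Open Scope card_scope.

(** * Cardinals and well-orders *)

Definition injects (A B : Type) : Prop := exists f : A -> B, injective f.

Lemma injects_refl (A : Type) : injects A A.
Proof. by exists id. Qed.

Lemma injects_trans (A B C : Type) : injects A B -> injects B C -> injects A C.
Proof. by move=> [f fI] [g gI]; exists (g \o f); exact: inj_comp. Qed.

Lemma injects_prod (A B C D : Type) :
  injects A C -> injects B D -> injects (A * B) (C * D).
Proof.
by move=> [f fI] [g gI]; exists (fun p => (f p.1, g p.2)) => -[a b] [c d] /= [/fI -> /gI ->].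
Qed.

Lemma injects_sum (A B C D : Type) :
  injects A C -> injects B D -> injects (A + B) (C + D).
Proof.
move=> [f fI] [g gI].
exists (fun p => match p with inl a => inl (f a) | inr b => inr (g b) end).
by move=> [a|b] [c|d] //= [] => [/fI ->|/gI ->].
Qed.

Lemma cleP (K L : cardinal) : cle K L <-> injects K L.
Proof.
split.
  move=> /card_leP[f]; exists (fun x => val (f (to_setT x))) => x y e.
  have := 'inj_f; move=> /(_ (to_setT x) (to_setT y)).
  rewrite !in_setT => /(_ isT isT (val_inj e)) /(congr1 val).
  by [].
move=> [f fI]; apply: card_le_trans (card_leT (f @` setT)).
have /card_eqPle[_ //] : f @` setT #= [set: K].
by apply: inj_card_eq => x y _ _; exact: fI.
Qed.

Lemma ceq_injects (K L : cardinal) : ceq K L <-> injects K L /\ injects L K.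
Proof. by rewrite -!cleP /ceq card_eqPle. Qed.

Lemma ceq_bij (K L : cardinal) : ceq K L -> exists f : K -> L, bijective f.
Proof.
move=> /card_bijP[f [g fK gK]]; exists (fun x => val (f (to_setT x))).
exists (fun y => val (g (to_setT y))) => x.
  by rewrite (_ : to_setT _ = f (to_setT x)) ?fK //; exact: val_inj.
by rewrite (_ : to_setT _ = g (to_setT x)) ?gK //; exact: val_inj.
Qed.

Lemma chain_common (T : Type) (F : set (set T)) (x y : T) : total_on F subset ->
  (\bigcup_(X in F) X) x -> (\bigcup_(X in F) X) y ->
  exists X, [/\ F X, X x & X y].
Proof.
move=> tot [X FX Xx] [Y FY Yy]; have [XY|YX] := tot X Y FX FY.
  by exists Y; split=> //; exact: XY.
by exists X; split=> //; exact: YX.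
Qed.

(** A maximal graph of a partial injection is total on one of the two sides: otherwise an unmatched
    element on each side would give a new pair. *)
Lemma injects_total (A B : Type) : injects A B \/ injects B A.
Proof.
pose P (G : set (A * B)) := forall p q, G p -> G q -> p.1 = q.1 <-> p.2 = q.2.
have [F FP tot p q Fp Fq|G [GP Gmax]] := @Zorn_bigcup _ P.
  by have [X [/FP XP Xp Xq]] := chain_common tot Fp Fq; exact: XP.
have [/choice[f fG]|/existsNP[a aG]] := pselect (forall a, exists b, G (a, b)).
  by left; exists f => x y e; apply/(GP _ _ (fG x) (fG y)).
have [/choice[f fG]|/existsNP[b bG]] := pselect (forall b, exists a, G (a, b)).
  by right; exists f => x y e; apply/(GP _ _ (fG x) (fG y)).
case: (Gmax (fun p => G p \/ p = (a, b))).
  split; first by move=> p Gp; left.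
  by move=> sub; apply: aG; exists b; apply: sub; right.
have old p : G p -> p.1 = a <-> p.2 = b.
  by case: p => x y /= Gp; split=> e; subst; [case: aG; exists y|case: bG; exists x].
move=> p q [Gp|->] [Gq|->] //=; first exact: GP; first exact: old.
by split=> /esym/(old _ Gq)/esym.
Qed.

Lemma infinite_injects (X : cardinal) : cinfinite X <-> injects nat X.
Proof. by rewrite /cinfinite infiniteP -cleP. Qed.

Lemma sval_inj (T : Type) (P : T -> Prop) : injective (@sval T P).
Proof. by move=> [x px] [y py] /= e; exact: eq_exist. Qed.

(** * Pairing functions on infinite types *)

Section SquareInjects.
Variable X : Type.

(* [(x, y, z)] in [G] means that the pair [(x, y)] is sent to [z]. *)
Let dom (G : set (X * X * X)) : set X := fun x => exists z, G (x, x, z).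

(** [G] is the graph of an injection of [dom G * dom G] into [dom G]. The domain is read off the
    diagonal, so that Zorn's lemma can be applied to the graphs alone. *)
Let pairing (G : set (X * X * X)) : Prop :=
  [/\ forall x y, dom G x -> dom G y -> exists2 z, dom G z & G (x, y, z),
      forall x y z, G (x, y, z) -> [/\ dom G x, dom G y & dom G z],
      forall x y z z', G (x, y, z) -> G (x, y, z') -> z = z' &
      forall p q z, G (p, z) -> G (q, z) -> p = q].

Let domS (G G' : set (X * X * X)) x : G `<=` G' -> dom G x -> dom G' x.
Proof. by move=> s [z /s Gz]; exists z. Qed.

Let pairing_bigcup (F : set (set (X * X * X))) :
  F `<=` pairing -> total_on F subset -> pairing (\bigcup_(G in F) G).
Proof.
move=> FP tot.
have up G x : F G -> dom G x -> dom (\bigcup_(G in F) G) x.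
  by move=> FG; apply: domS => p Gp; exists G.
split.
- move=> x y [z Uz] [t Ut].
  have [G [FG Gz Gt]] := chain_common tot Uz Ut.
  have [G1 _ _ _] := FP _ FG.
  have [w wG Gw] := G1 x y (ex_intro _ z Gz) (ex_intro _ t Gt).
  by exists w; [exact: up FG wG|exists G].
- move=> x y z [G FG Gxyz]; have [_ G2 _ _] := FP _ FG.
  by have [dx dy dz] := G2 _ _ _ Gxyz; split; exact: up FG _.
- move=> x y z z' Uz Uz'; have [G [FG Gz Gz']] := chain_common tot Uz Uz'.
  by have [_ _ G3 _] := FP _ FG; exact: G3 Gz Gz'.
- move=> p q z Uz Uz'; have [G [FG Gz Gz']] := chain_common tot Uz Uz'.
  by have [_ _ _ G4] := FP _ FG; exact: G4 Gz Gz'.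
Qed.

Let pairing_nat : injects nat X -> exists G, pairing G /\ exists f : nat -> X,
  injective f /\ forall n, dom G (f n).
Proof.
move=> [f fI]; pose c (p : nat * nat) := choice.pickle p.
pose G : set (X * X * X) :=
  fun p => exists a b, p = (f a, f b, f (c (a, b))).
have dG n : dom G (f n) by exists (f (c (n, n))), n, n.
have cI : injective c by exact: pcan_inj (@choice.pickleK _).
exists G; split; last by exists f.
split.
- move=> x y [_ [a [_ [-> _ _]]]] [_ [b [_ [-> _ _]]]].
  by exists (f (c (a, b))) => //; exists a, b.
- by move=> x y z [a [b [-> -> ->]]].
- move=> x y z z' [a [b [-> -> ->]]] [a' [b' [/fI <- /fI <- ->]]] //.
- move=> p q z [a [b [-> ->]]] [a' [b' [-> /fI/cI[-> ->]]]] //.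
Qed.

(** When a copy [j D] of the domain [D] fits outside [D], the pairs with a coordinate in the copy
    are sent into the copy: their values [j (m (tag, m (d, d')))], with [m] the given pairing, are
    outside the old domain. *)
Let extend (G : set (X * X * X)) (f : nat -> X) (j : {x | dom G x} -> {x | ~ dom G x}) :
  pairing G -> injective f -> (forall n, dom G (f n)) -> injective j ->
  exists G', G `<` G' /\ pairing G'.
Proof.
move=> [G1 G2 G3 G4] fI fG jI; pose D := {x | dom G x}.
have /choice[m mP] (p : D * D) : exists z : D, G (sval p.1, sval p.2, sval z).
  case: p => [[x dx] [y dy]]; have [z dz Gz] := G1 _ _ dx dy.
  by exists (exist _ z dz).
have mI : injective m.
  move=> p q e; have := mP p; rewrite e => /G4 /(_ (mP q)).
  by case: p q {e} => [a b] [c d] /= [/sval_inj-> /sval_inj->].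
pose u (b : bool) (d : D) : X := if b then sval (j d) else sval d.
have uN b d : dom G (u b d) <-> b = false.
  case: b; rewrite /u; last by split=> // _; exact: (svalP d).
  by split=> // /(svalP (j d)).
have uI b b' d d' : u b d = u b' d' -> b = b' /\ d = d'.
  move=> e; have bb : b = b'.
    have := uN b d; rewrite e; have := uN b' d'.
    by case: (b) (b') => [] [] // [h1 h2] [h3 h4]; [have := h3 (h2 erefl)|have := h1 (h4 erefl)].
  subst b'; split=> //; case: b e => /= /sval_inj //; exact: jI.
pose nd (n : nat) : D := exist _ (f n) (fG n).
have ndI : injective nd by move=> n k /(congr1 sval)/fI.
(* Two bits, stored as one of four elements of [D], record which coordinates lie in the copy. *)
pose tag (b b' : bool) := nd (b + 2 * b')%N.
have tagI a a' b b' : tag a a' = tag b b' -> a = b /\ a' = b'.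
  by move=> /ndI; case: a a' b b' => [] [] [] [].
pose new b b' d d' := j (m (tag b b', m (d, d'))).
pose G' : set (X * X * X) := fun p => G p \/ exists b b' d d',
  (b || b') /\ p = (u b d, u b' d', sval (new b b' d d')).
have GG' : G `<=` G' by move=> p; left.
have dG' x : dom G' x <-> exists b d, x = u b d.
  split=> [[z [Gz|[b [b' [d [d' [_ [-> _ _]]]]]]]]|[b [d ->]]].
  - by have [dx _ _] := G2 _ _ _ Gz; exists false, (exist _ x dx).
  - by exists b, d.
  case: b; last by apply: domS GG' _; exact/uN.
  by exists (sval (new true true d d)); right; exists true, true, d, d.
have newd b b' d d' : sval (new b b' d d') = u true (m (tag b b', m (d, d'))) by [].
have notdom b b' d d' : ~ dom G (sval (new b b' d d')) by exact: (svalP (new _ _ _ _)).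
have newI a a' b b' c c' d d' : sval (new a a' c c') = sval (new b b' d d') ->
    [/\ a = b, a' = b', c = d & c' = d'].
  by move=> /sval_inj/jI/mI[/fI e1 /mI[-> ->]]; have [-> ->] := tagI _ _ _ _ (congr1 nd e1).
exists G'; split.
  split=> // sub; pose d := nd 0.
  have [|_ _ /notdom//] := G2 (u true d) (u true d) (sval (new true true d d)).
  by apply: sub; right; exists true, true, d, d.
split.
- move=> x y /dG'[b [d ->]] /dG'[b' [d' ->]].
  have [bb|] := boolP (b || b').
    by exists (sval (new b b' d d')); [apply/dG'; rewrite newd; eexists; eexists; reflexivity|
      right; exists b, b', d, d'].
  rewrite negb_or => /andP[/negbTE-> /negbTE->].
  exists (sval (m (d, d'))); last by left; exact: mP (d, d').
  by apply/dG'; exists false, (m (d, d')).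
- move=> x y z [/G2[dx dy dz]|[b [b' [d [d' [_ [-> -> ->]]]]]]].
    by split; exact: domS GG' _.
  by split; apply/dG'; rewrite ?newd; eexists; eexists; reflexivity.
- move=> x y z z' [Gz|[b [b' [d [d' [bb [-> -> ->]]]]]]] [Gz'|].
  + exact: G3 Gz Gz'.
  + move=> [b [b' [d [d' [bb [xE yE _]]]]]].
    by have [] := G2 _ _ _ Gz; rewrite xE yE => /uN b0 /uN b'0; rewrite b0 b'0 in bb.
  + by have [/uN b0 /uN b'0 _] := G2 _ _ _ Gz'; rewrite b0 b'0 in bb.
  + by move=> [c [c' [e [e' [_ [/uI[-> ->] /uI[-> ->] ->]]]]]].
- move=> p q z [Gz|[b [b' [d [d' [bb [-> ->]]]]]]] [Gz'|].
  + exact: G4 Gz Gz'.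
  + case: p Gz => x y Gz [b [b' [d [d' [bb [_ zE]]]]]].
    by have [_ _] := G2 _ _ _ Gz; rewrite zE => /notdom.
  + by case: q Gz' => x y Gz'; have [_ _ /notdom] := G2 _ _ _ Gz'.
  + by move=> [c [c' [e [e' [_ [-> /newI[-> -> -> ->]]]]]]].
Qed.

(** The complement of the domain [D] of a maximal pairing injects into [D], since otherwise [extend]
    applies. Then [X] injects into [D + D], hence into [D * D] and into [D]. *)
Lemma square_injects : injects nat X -> injects (X * X) X.
Proof.
move=> /pairing_nat[G0 [G0p [f [fI fG0]]]].
pose P (G : set (X * X * X)) := G = set0 \/ G0 `<=` G /\ pairing G.
have [F FP tot|G [GP Gmax]] := @Zorn_bigcup _ P.
  have [[G FG G0G]|nF] := pselect (exists2 G, F G & G0 `<=` G); last first.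
    left; rewrite predeqE => p; split=> // -[G FG Gp].
    have [e|[sG _]] := FP _ FG; first by rewrite e in Gp.
    by case: nF; exists G.
  right; split; first by move=> p /G0G; exists G.
  have -> : \bigcup_(G in F) G = \bigcup_(G in F `&` [set G | G != set0]) G.
    rewrite predeqE => p; split=> -[H FH Hp]; last by case: FH => FH _; exists H.
    by exists H => //; split=> //=; apply/set0P; exists p.
  apply: pairing_bigcup; last by move=> A B [FA _] [FB _]; exact: tot.
  by move=> H [FH /eqP H0]; have [|[]] := FP _ FH.
have G00 : G0 !=set0 by have [z zP] := fG0 0%N; eexists; exact: zP.
have {GP} [e|[G0G Gp]] := GP.
  case: (Gmax G0); last by right; split.
  by rewrite e; split=> // sub; case: G00 => p /sub.
have fG n : dom G (f n) by exact: domS (fG0 n).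
pose D := {x | dom G x}; pose E := {x | ~ dom G x}.
have [[j jI]|EF] := injects_total D E.
  have [G' [ltG Gp']] := extend Gp fI fG jI.
  by case: (Gmax _ ltG); right; split=> //; exact: subset_trans (properW ltG).
have DDD : injects (D * D) D.
  have [G1 G2 G3 G4] := Gp.
  have /choice[m mP] (p : D * D) : exists z : D, G (sval p.1, sval p.2, sval z).
    case: p => [[x dx] [y dy]]; have [z dz Gz] := G1 _ _ dx dy.
    by exists (exist _ z dz).
  exists m => p q e; have := mP p; rewrite e => /G4 /(_ (mP q)).
  by case: p q {e} => [a b] [c d] /= [/sval_inj-> /sval_inj->].
pose nd (n : nat) : D := exist _ (f n) (fG n).
have ndI : injective nd by move=> n k /(congr1 sval)/fI.
have XD : injects X D.
  apply: injects_trans DDD; apply: (@injects_trans _ (D + E)).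
    exists (fun x => match pselect (dom G x) with
      left h => inl (exist _ x h) | right h => inr (exist _ x h) end).
    by move=> x y; case: pselect => hx; case: pselect => hy // -[].
  case: EF => e eI.
  exists (fun s => match s with inl d => (nd 0%N, d) | inr x => (nd 1%N, e x) end).
  move=> [d|x] [d'|y] // [].
  - by move=> ->.
  - by move=> /fI.
  - by move=> /fI.
  - by move=> /eI ->.
apply: injects_trans (injects_prod XD XD) _.
apply: injects_trans DDD _.
by exists sval; exact: sval_inj.
Qed.

End SquareInjects.

Lemma seq_injects (X : Type) : injects nat X -> injects (seq X) X.
Proof.
move=> natX; have [p pI] := square_injects natX.
have [f fI] := natX.
apply: injects_trans (ex_intro _ p pI); apply: injects_trans (injects_prod natX (injects_refl X)).
(* The length is kept beside the iterated pairing, which alone does not show where the sequence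
   stops. *)
exists (fun s => (size s, foldr (fun x z => p (x, z)) (f 0%N) s)).
by elim=> [|x s IH] [|y t] //= [st /pI[-> e]]; rewrite (IH t) // st e.
Qed.

Lemma sum_injects (X Y Z : Type) : injects nat Z -> injects X Z -> injects Y Z ->
  injects (X + Y) Z.
Proof.
move=> natZ XZ YZ; apply: injects_trans (injects_sum XZ YZ) _.
apply: injects_trans (square_injects natZ); have [f fI] := natZ.
exists (fun s => match s with inl x => (f 0%N, x) | inr x => (f 1%N, x) end).
by move=> [x|x] [y|y] // [] => [->|/fI|/fI|->].
Qed.

Lemma prod_injects (X Y Z : Type) : injects nat Z -> injects X Z -> injects Y Z ->
  injects (X * Y) Z.
Proof.
move=> natZ XZ YZ; exact: injects_trans (injects_prod XZ YZ) (square_injects natZ).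
Qed.

Lemma cantor (X : Type) : ~ injects (X -> bool) X.
Proof.
move=> [f fI]; pose S x := ~~ `[< exists2 g, f g = x & g x >].
have : S (f S) = ~~ S (f S); last by case: (S _).
rewrite {1}/S; congr (~~ _).
by apply/asboolP/idP => [[g /fI->]|] //; exists S.
Qed.

(** * Well-orders *)

Section WellOrder.
Variables (T : Type) (le : rel T).
Hypothesis wo : well_order le.

Lemma wo_min (P : set T) x : P x -> exists2 z, P z & forall y, P y -> le z y.
Proof.
move=> Px; have [|z [[zP zmin] _]] := wo (A := [pred y | `[< P y >]]).
  by exists x; exact/asboolP.
by exists z; [exact/asboolP|move=> y Py; apply: zmin; exact/asboolP].
Qed.

Lemma wo_total x y : le x y \/ le y x.
Proof.
have [z [->|->] zmin] := @wo_min (fun z => z = x \/ z = y) x (or_introl erefl).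
  by left; apply: zmin; right.
by right; apply: zmin; left.
Qed.

Lemma wo_refl x : le x x.
Proof. by case: (wo_total x x). Qed.

Lemma wo_anti x y : le x y -> le y x -> x = y.
Proof.
move=> xy yx; have [|z [_ zu]] := wo (A := [pred z | `[< z = x \/ z = y >]]).
  by exists x; apply/asboolP; left.
have <- : z = x.
  by apply: zu; split=> [|t /asboolP[]->]; rewrite ?wo_refl //; apply/asboolP; left.
by apply: zu; split=> [|t /asboolP[]->]; rewrite ?wo_refl //; apply/asboolP; right.
Qed.

Lemma wo_trans x y z : le x y -> le y z -> le x z.
Proof.
move=> xy yz.
have [t [|[|]] -> tmin] := @wo_min (fun t => t = x \/ t = y \/ t = z) x (or_introl erefl).
- by apply: tmin; auto.
- by rewrite (wo_anti xy) //; apply: tmin; auto.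
- by rewrite -(wo_anti yz) //; apply: tmin; auto.
Qed.

Lemma wltNge x y : wlt le x y <-> ~ le y x.
Proof. by split=> /negP. Qed.

Lemma wltW x y : wlt le x y -> le x y.
Proof. by move=> /wltNge; case: (wo_total x y). Qed.

Lemma wlt_le_trans x y z : wlt le x y -> le y z -> wlt le x z.
Proof. by move=> /wltNge xy yz; apply/wltNge => zx; apply: xy; exact: wo_trans zx. Qed.

Lemma wlt_irr x : ~ wlt le x x.
Proof. by move=> /wltNge; apply; exact: wo_refl. Qed.

Lemma wlt_or x y : [\/ wlt le x y, x = y | wlt le y x].
Proof.
have [xy|/wltNge yx] := pselect (le x y); last by constructor 3.
have [yx|/wltNge xy'] := pselect (le y x); last by constructor 1.
by constructor 2; exact: wo_anti.
Qed.

Lemma wlt_wf : well_founded (wlt le).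
Proof.
move=> x; apply: contrapT => nx.
have [z nz zmin] := @wo_min (fun x => ~ Acc (wlt le) x) x nx.
by apply: nz; constructor=> y /wltNge yz; apply: contrapT => /zmin.
Qed.

End WellOrder.

(** * Growth of the beth function *)

Section Beth.
Variables (W : cardinal) (le : rel W) (b : W -> cardinal).
Hypothesis wo : well_order le.
Hypothesis bE : forall x, beth_eqn le (wbelow le x) b (b x).

(** Monotonicity is assumed on [P] only, so that the lemma serves inside the induction proving
    [beth_mono] and again for the final value, where [P] is everything. *)
Lemma beth_eqn_ub (P : set W) (T : cardinal) : beth_eqn le P b T ->
  (forall x y, P y -> wlt le x y -> injects (b x) (b y)) ->
  forall y, P y -> injects (b y) T.
Proof.
move=> [_ Psucc Plim] bmono y Py.
have [[z zP]|ng] := pselect (exists z, is_greatest le P z); last first.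
  by apply/cleP; have [] := Plim (ex_intro _ y Py) ng; move=> + _; exact.
have /ceq_injects[_ zT] := Psucc _ zP.
(* Singletons embed [b z] into its power set. *)
have {zT} : injects (b z) T.
  apply: injects_trans zT; exists (fun x y => `[< x = y >]).
  by move=> x x' /(congr1 (fun f => f x')) /=; rewrite [RHS]asboolT // => /asboolP.
have [Pz zmax] := zP.
have [/(bmono _ _ Pz)|->|/wltNge[]] // := wlt_or wo y z; last exact: zmax.
exact: injects_trans.
Qed.

Lemma beth_mono x y : wlt le x y -> injects (b x) (b y).
Proof.
elim/(well_founded_ind (wlt_wf wo)): y x => y IH x xy.
exact: (beth_eqn_ub (bE y) (fun u v vy uv => IH v vy u uv) xy).
Qed.

Lemma beth_pow x y : wlt le x y -> injects (cpow2 (b x)) (b y).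
Proof.
(* The least element [z] above [x] is its successor, so [b z] has the size of the power set of
   [b x]. *)
move=> xy; have [z xz zmin] := wo_min wo xy (P := wlt le x).
have [_ zsucc _] := bE z.
have /zsucc/ceq_injects[_ xz'] : is_greatest le (wbelow le z) x.
  split=> // u uz; have [|->|xu] := wlt_or wo u x; [exact: wltW|exact: wo_refl|].
  by have /wltNge[] := uz; exact: zmin.
apply: injects_trans xz' _.
have [/beth_mono //|->|/wltNge[]] := wlt_or wo z y; [exact: injects_refl|exact: zmin].
Qed.

End Beth.

(* If [bound] had size at most [K], the [b y], of pairwise distinct sizes, would
   have distinct images in [K], and [W] would inject into [2^K]. *)
Lemma beth_unbounded (K W : cardinal) (le : rel W) (bound : cardinal) :
  is_succ_cardinal (cpow2 K) le -> is_beth le bound -> ~ injects bound K.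
Proof.
move=> [wo WK _] [b [bE boundE]] [f fI]; apply: WK; apply/cleP.
have bK x : injects (b x) K.
  apply: injects_trans (ex_intro _ f fI).
  by apply: beth_eqn_ub boundE _ _ _ => // u v _; exact: beth_mono.
pose g x := sval (cid (bK x)); have gI x : injective (g x) := svalP (cid (bK x)).
exists (fun y k => `[< exists z, g y z = k >]).
(* Equal ranges in [K] would inject [b y], hence the power set of [b x], into [b x]. *)
have notlt x y : wlt le x y ->
    (fun k => `[< exists z, g x z = k >]) <> (fun k => `[< exists z, g y z = k >]).
  move=> xy e; apply: (@cantor (b x)); apply: injects_trans (beth_pow wo bE xy) _.
  have /choice[h hP] v : exists z, g x z = g y v.
    apply/asboolP; have /= -> := congr1 (fun F : K -> bool => F (g y v)) e.
    by apply/asboolP; exists v.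
  by exists h => v v' /(congr1 (g x)); rewrite !hP => /gI.
move=> x y e; have [/notlt/(_ e)|//|/notlt/(_ (esym e))] := wlt_or wo x y; by [].
Qed.

(** * Modules and linear maps *)

Section Modules.
Variable R : pzRingType.

Definition mk_linear (M N : rmodType R) (f : M -> N) (fl : linear f) : {linear M -> N} :=
  HB.pack f (GRing.isLinear.Build R^c M N *:%R f fl).

Definition bpred (M : Type) (P : M -> Prop) : {pred M} := fun x => `[< P x >].

Lemma bpredE (M : Type) (P : M -> Prop) x : x \in bpred P <-> P x.
Proof. by split=> /asboolP. Qed.

Definition mk_submod (M : rmodType R) (P : M -> Prop) (PP : submod_closed (bpred P)) :
  submodClosed M :=
  HB.pack (bpred P) (GRing.isSubmodClosed.Build R^c M (bpred P) PP).

Lemma exists_submod (M : rmodType R) (P : M -> Prop) :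
  P 0 -> (forall a x y, P x -> P y -> P (a *: x + y)) ->
  exists A : submodClosed M, forall x, x \in A <-> P x.
Proof.
move=> P0 PD; have PP : submod_closed (bpred P).
  by split=> [|a x y /bpredE Px /bpredE Py]; apply/bpredE => //; exact: PD.
by exists (mk_submod PP) => x; exact: bpredE.
Qed.

(** A relation closed under linear combinations is functional as soon as it is so at 0, because the
    difference of two values at [x] is a value at 0. *)
Lemma linear_of_graph (M N : rmodType R) (G : M -> N -> Prop) :
  G 0 0 -> (forall a x x' y y', G x y -> G x' y' -> G (a *: x + x') (a *: y + y')) ->
  (forall x, exists y, G x y) -> (forall y, G 0 y -> y = 0) ->
  exists f : {linear M -> N}, forall x, G x (f x).
Proof.
move=> G0 GD /choice[f fG] GI.
have GB x x' y y' : G x y -> G x' y' -> G (x - x') (y - y').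
  by move=> Gy Gy'; have := GD (-1) _ _ _ _ Gy' Gy; rewrite !scaleN1r !(addrC (- _)).
have funG x y y' : G x y -> G x y' -> y = y'.
  move=> Gy Gy'; apply/eqP; rewrite -subr_eq0; apply/eqP/GI.
  by have := GB _ _ _ _ Gy Gy'; rewrite subrr.
have fl : linear f by move=> a x y; apply: (funG _ _ _ (fG _)); exact: GD.
by exists (mk_linear fl).
Qed.

Lemma exists_restrict (M N : rmodType R) (f : {linear M -> N}) (B : submodClosed N) :
  (forall x, f x \in B) -> exists g : {linear M -> subm B}, forall x, val (g x) = f x.
Proof.
move=> fB; pose g x : subm B := exist _ (f x) (fB x).
have gl : linear g by move=> a x y; apply: val_inj; rewrite linearP /= linearP.
by exists (mk_linear gl).
Qed.

Lemma iso_inj_surj (M N : rmodType R) (f : {linear M -> N}) :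
  (forall x, f x = 0 -> x = 0) -> (forall y, exists x, f x = y) -> isomorphic M N.
Proof.
move=> f0 /choice[g gK]; exists f; exists g => // x.
by apply/eqP; rewrite -subr_eq0; apply/eqP/f0; rewrite linearB /= gK subrr.
Qed.

Lemma iso_of_inverse (M N : rmodType R) (f : {linear M -> N}) (g : {linear N -> M}) :
  cancel f g -> cancel g f -> isomorphic M N.
Proof. by move=> fK gK; exists f; exists g. Qed.

Lemma iso_inverse (M N : rmodType R) : isomorphic M N ->
  exists (f : {linear M -> N}) (g : {linear N -> M}), cancel f g /\ cancel g f.
Proof.
move=> [f [g fK gK]]; exists f.
have gl : linear g.
  by move=> a x y; rewrite -[in LHS](gK x) -[in LHS](gK y) -linearP fK.
by exists (mk_linear gl).
Qed.

Lemma iso_refl (M : rmodType R) : isomorphic M M.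
Proof. by exists idfun; exists id. Qed.

Lemma iso_sym (M N : rmodType R) : isomorphic M N -> isomorphic N M.
Proof. by move=> /iso_inverse[f [g [fK gK]]]; exists g; exists f. Qed.

Lemma iso_trans (M N P : rmodType R) :
  isomorphic M N -> isomorphic N P -> isomorphic M P.
Proof.
move=> [f fb] [g gb]; exists (g \o f : {linear _ -> _}).
exact: bij_comp.
Qed.

Lemma iso_prod (M M' N N' : rmodType R) : isomorphic M M' -> isomorphic N N' ->
  isomorphic (M * N)%type (M' * N')%type.
Proof.
move=> [f [f' fK f'K]] [g [g' gK g'K]]; pose h (p : M * N) := (f p.1, g p.2).
have hl : linear h by move=> a x y; rewrite /h !linearP.
exists (mk_linear hl); exists (fun p => (f' p.1, g' p.2)) => -[x y] /=; rewrite /h /=.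
  by rewrite fK gK.
by rewrite f'K g'K.
Qed.

(** The pairs [(f x, f' x)] form the graph of the isomorphism. This plays the part of the
    isomorphism theorems when quotients are compared. *)
Lemma iso_same_kernel (M N N' : rmodType R) (f : {linear M -> N}) (f' : {linear M -> N'}) :
  (forall y, exists x, f x = y) -> (forall y, exists x, f' x = y) ->
  (forall x, f x = 0 <-> f' x = 0) -> isomorphic N N'.
Proof.
move=> fS f'S ker.
have [|a x x' y y' [u [<- <-]] [v [<- <-]]|y|y [x [/ker -> ->]]|g gP] //
  := @linear_of_graph N N' (fun y y' => exists x, f x = y /\ f' x = y').
- by exists 0; rewrite !raddf0.
- by exists (a *: u + v); rewrite !linearP.
- by have [x <-] := fS y; exists (f' x), x.
apply: (@iso_inj_surj _ _ g) => [y gy0|y].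
  by have [x []] := gP y; rewrite gy0 => <- /ker.
have [x <-] := f'S y; exists (f x); have [x' [e <-]] := gP (f x).
apply/eqP; rewrite -subr_eq0 -linearB; apply/eqP/ker.
by rewrite linearB /= e subrr.
Qed.

(** Corestricting both maps to the image of [g] reduces this to a surjective [g]. *)
Lemma projective_lift (P M N : rmodType R) (g : {linear M -> N}) (f : {linear P -> N}) :
  projective P -> (forall x, exists y, g y = f x) ->
  exists h : {linear P -> M}, forall x, g (h x) = f x.
Proof.
move=> prP fg.
have [||B BE] := @exists_submod N (fun z => exists y, g y = z).
- by exists 0; rewrite raddf0.
- by move=> a x y [u <-] [v <-]; exists (a *: u + v); rewrite linearP.
have [|f' f'E] := @exists_restrict _ _ f B; first by move=> x; apply/BE.
have [|g' g'E] := @exists_restrict _ _ g B; first by move=> x; apply/BE; exists x.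
have [|h hP] := prP _ _ g' f'.
  move=> [z zB]; have /BE[y yz] := zB; exists y; apply: val_inj.
  by rewrite g'E.
by exists h => x; rewrite -g'E hP.
Qed.

Lemma projective_retract (P Q : rmodType R) (i : {linear Q -> P}) (p : {linear P -> Q}) :
  cancel i p -> projective P -> projective Q.
Proof.
move=> ipK prP M N g f gS; have [h hP] := prP _ _ g (f \o p : {linear _ -> _}) gS.
by exists (h \o i : {linear _ -> _}) => x /=; rewrite hP /= ipK.
Qed.

Lemma projective_iso (P Q : rmodType R) : isomorphic P Q -> projective P -> projective Q.
Proof. by move=> /iso_inverse[f [g [_ gK]]]; exact: projective_retract gK. Qed.

Definition inl_lin (M N : rmodType R) (x : M) : (M * N)%type := (x, 0).
Definition inr_lin (M N : rmodType R) (y : N) : (M * N)%type := (0, y).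
Lemma inl_lin_linear M N : linear (@inl_lin M N).
Proof. by move=> a x y; rewrite /inl_lin; congr pair; rewrite /= scaler0 addr0. Qed.
Lemma inr_lin_linear M N : linear (@inr_lin M N).
Proof. by move=> a x y; rewrite /inr_lin; congr pair; rewrite /= scaler0 addr0. Qed.
HB.instance Definition _ (M N : rmodType R) :=
  GRing.isLinear.Build R^c M (M * N)%type *:%R (@inl_lin M N) (@inl_lin_linear M N).
HB.instance Definition _ (M N : rmodType R) :=
  GRing.isLinear.Build R^c N (M * N)%type *:%R (@inr_lin M N) (@inr_lin_linear M N).

Definition copair (M M' N : rmodType R) (f : {linear M -> N}) (g : {linear M' -> N})
  (p : (M * M')%type) : N := f p.1 + g p.2.
Lemma copair_linear M M' N f g : linear (@copair M M' N f g).
Proof.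
by move=> a x y; rewrite /copair !linearP /= scalerDr addrACA.
Qed.
HB.instance Definition _ (M M' N : rmodType R) (f : {linear M -> N}) (g : {linear M' -> N}) :=
  GRing.isLinear.Build R^c (M * M')%type N *:%R (@copair M M' N f g) (@copair_linear M M' N f g).

Definition pairing (M N N' : rmodType R) (f : {linear M -> N}) (g : {linear M -> N'})
  (x : M) : (N * N')%type := (f x, g x).
Lemma pairing_linear M N N' f g : linear (@pairing M N N' f g).
Proof. by move=> a x y; rewrite /pairing !linearP. Qed.
HB.instance Definition _ (M N N' : rmodType R) (f : {linear M -> N}) (g : {linear M -> N'}) :=
  GRing.isLinear.Build R^c M (N * N')%type *:%R (@pairing M N N' f g) (@pairing_linear M N N' f g).

Lemma projective_prod (P Q : rmodType R) :
  projective P -> projective Q -> projective (P * Q)%type.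
Proof.
move=> prP prQ M N g f gS.
have [h hP] := prP _ _ g (f \o @inl_lin P Q : {linear _ -> _}) gS.
have [k kP] := prQ _ _ g (f \o @inr_lin P Q : {linear _ -> _}) gS.
exists (copair h k : {linear _ -> _}) => -[x y]; rewrite /copair linearD hP kP /=.
by rewrite -linearD; congr (f (_, _)); rewrite /= ?addr0 ?add0r.
Qed.

Lemma projective_summand (M P : rmodType R) (g : {linear M -> P}) :
  projective P -> (forall y, exists x, g x = y) ->
  exists N : rmodType R, isomorphic M (P * N)%type.
Proof.
move=> prP gS; have [h hP] := prP _ _ g idfun gS.
have [||B BE] := @exists_submod M (fun x => g x = 0).
- by rewrite raddf0.
- by move=> a x y gx gy; rewrite linearP gx gy scaler0 addr0.
exists (subm B).
(* The complement is the kernel of [g]; [idfun - h g] projects onto it along the image of the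
   section [h]. *)
have [|f fE] := @exists_restrict _ _ (idfun \- (h \o g) : {linear _ -> _}) B.
  by move=> x; apply/BE; rewrite /= linearB /= hP subrr.
apply: (@iso_inj_surj _ _ (pairing g f : {linear _ -> _})).
  move=> x [gx0 /(congr1 val)]; rewrite fE /= gx0 raddf0 subr0 => ->.
  reflexivity.
move=> [p b]; exists (h p + val b); have /BE gb := valP b.
have e : g (h p + val b) = p by rewrite linearD /= hP gb addr0.
by congr (_, _) => //; apply: val_inj; rewrite fE /= e addrC addKr.
Qed.

End Modules.

(** * Direct sums *)

Section Coproducts.
Variable R : pzRingType.

Section Spanned.
Variables (X : Type) (V : X -> rmodType R) (M : rmodType R).
Variable i : forall x, {linear V x -> M}.

(** The submodule generated by the images of the [i x] with [x] in [P]; the inductive form gives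
    induction on finite sums. *)
Inductive spanned (P : set X) : M -> Prop :=
| spanned0 : spanned P 0
| spannedD x v m : P x -> spanned P m -> spanned P (i x v + m).

Lemma spanned_add P m n : spanned P m -> spanned P n -> spanned P (m + n).
Proof.
elim=> [|x v m' Px _ IH sn]; rewrite ?add0r // -addrA.
by apply: spannedD => //; exact: IH.
Qed.

Lemma spanned_linear P a m n : spanned P m -> spanned P n -> spanned P (a *: m + n).
Proof.
move=> sm sn; apply: spanned_add sn.
elim: sm => [|x v m' Px _ IH]; first by rewrite scaler0; exact: spanned0.
by rewrite scalerDr -linearZ; exact: spannedD.
Qed.

Lemma spanned_gen (P : set X) x v : P x -> spanned P (i x v).
Proof. by move=> Px; rewrite -[i x v]addr0; apply: spannedD => //; exact: spanned0. Qed.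

Lemma spanned_sub (P Q : set X) m : P `<=` Q -> spanned P m -> spanned Q m.
Proof.
move=> PQ; elim=> [|x v n /PQ Qx _]; first exact: spanned0.
exact: spannedD.
Qed.

Definition generating : Prop := forall m, spanned setT m.

(** The universal property of the direct sum; uniqueness of [h] follows from generation, by
    [generating_ext]. *)
Definition coproduct : Prop := generating /\
  forall (N : rmodType R) (f : forall x, {linear V x -> N}),
    exists h : {linear M -> N}, forall x v, h (i x v) = f x v.

Lemma generating_ext (N : rmodType R) (f g : {linear M -> N}) : generating ->
  (forall x v, f (i x v) = g (i x v)) -> f =1 g.
Proof.
move=> gen fg m; elim: {m} (gen m) => [|x v m _ _ IH]; first by rewrite !raddf0.
by rewrite !linearD fg IH.
Qed.

Lemma spanned_seq m : generating ->
  exists s : seq {x & V x}, m = \sum_(p <- s) i (tag p) (tagged p).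
Proof.
move=> gen; elim: {m} (gen m) => [|x v m _ _ [s ->]]; first by exists [::]; rewrite big_nil.
by exists (Tagged V v :: s); rewrite big_cons.
Qed.

(** An element is a finite sum, hence coded by a finite sequence of pairs of an index and an element
    of the summand. *)
Lemma generating_injects (Z : Type) : injects nat Z -> injects X Z ->
  (forall x, injects (V x) Z) -> generating -> injects M Z.
Proof.
move=> natZ XZ VZ gen; apply: injects_trans (seq_injects natZ).
have tagZ : injects {x & V x} Z.
  pose f x := sval (cid (VZ x)); have fI x : injective (f x) := svalP (cid (VZ x)).
  apply: injects_trans (prod_injects natZ XZ (injects_refl Z)).
  exists (fun p => (tag p, f (tag p) (tagged p))).
  by move=> [x v] [y w] /= [xy]; subst y => /fI ->.
apply: (@injects_trans _ (seq {x & V x})).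
  exists (fun m => sval (cid (spanned_seq m gen))) => m m' e.
  by rewrite (svalP (cid (spanned_seq m gen))) (svalP (cid (spanned_seq m' gen))) e.
by have [g gI] := tagZ; exists (map g); exact: inj_map.
Qed.

Section Independent.
Variable le : rel X.
Hypothesis wo : well_order le.

(** Isolating the term of largest index prepares inductions along the well-order. *)
Lemma spanned_last P m : spanned P m ->
  m = 0 \/ exists x v a, [/\ P x, spanned (wbelow le x) a & m = a + i x v].
Proof.
elim=> [|x v {}m Px sm [->|[y [w [a [Py sa ->]]]]]]; first by left.
  by right; exists x, v, 0; split=> //; [exact: spanned0|rewrite addr0 add0r].
right; have [xy|xy|yx] := wlt_or wo x y.
- by exists y, w, (i x v + a); split=> //; [exact: spannedD|rewrite addrA].
- subst y; exists x, (v + w), a; split=> //.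
  by rewrite linearD addrCA.
- exists x, v, (i y w + a); split=> //; last by rewrite addrC (addrC a).
  apply: spannedD => //; apply: spanned_sub sa => z zy.
  exact (wlt_le_trans wo zy (wltW wo yx)).
Qed.

(** Each [i x] is injective and its image meets the span of the preceding ones trivially: the form
    in which a filtration yields a direct sum. *)
Definition independent : Prop :=
  forall x v, spanned (wbelow le x) (i x v) -> v = 0.

End Independent.
End Spanned.

(** The graph of the required map is the span of the pairs [(i x v, f x v)]. It is functional: in an
    element [(0, n)] of the span, the last term is zero by independence, so [(0, n)] already lies in
    the span of smaller indices, and induction gives [n = 0]. *)
Lemma independent_coproduct (X : Type) (V : X -> rmodType R) (M : rmodType R)
    (i : forall x, {linear V x -> M}) (le : rel X) :
  well_order le -> generating i -> independent i le -> coproduct i.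
Proof.
move=> wo gen ind; split=> // N f.
pose k x : {linear V x -> (M * N)%type} := pairing (i x) (f x).
have proj P p : spanned k P p -> spanned i P p.1.
  by elim=> [|x v m Px _]; [exact: spanned0|exact: spannedD].
have step P : (forall y n, P y -> spanned k (wbelow le y) (0, n) -> n = 0) ->
    forall n, spanned k P (0, n) -> n = 0.
  move=> IH n /(spanned_last wo)[[]//|[y [v [[m n'] [Py sa]]]]] [e ->].
  have v0 : v = 0.
    apply: (ind y); have /proj/= := sa => sm.
    have -> : i y v = -1 *: m + 0.
      by apply/eqP; rewrite addr0 scaleN1r -subr_eq0 opprK addrC -e.
    by apply: spanned_linear sm _; exact: spanned0.
  by move: e sa; rewrite v0 !raddf0 !addr0 => <-; exact: IH.
have fun0 x : forall n, spanned k (wbelow le x) (0, n) -> n = 0.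
  elim/(well_founded_ind (wlt_wf wo)): x => x IH.
  by apply: step => y n yx; exact: IH.
have {step} fun0 : forall n, spanned k setT (0, n) -> n = 0.
  by apply: step => y n _; exact: fun0.
have [|a m m' n n'|m|//|h hP] := @linear_of_graph _ M N (fun m n => spanned k setT (m, n)).
- exact: spanned0.
- by move=> s s'; have := spanned_linear a s s'.
- elim: {m} (gen m) => [|x v m _ _ [n sn]]; first by exists 0; exact: spanned0.
  by exists (f x v + n); exact: (@spannedD _ _ _ k setT x v (m, n)).
exists h => x v; apply/eqP; rewrite -subr_eq0; apply/eqP/fun0.
have := spanned_linear (-1) (@spanned_gen _ _ _ k setT x v I) (hP (i x v)).
have -> // : -1 *: k x v + (i x v, h (i x v)) = (0, h (i x v) - f x v).
by rewrite scaleN1r /= /pairing; congr pair; rewrite /= addrC ?subrr.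
Qed.

Lemma coproduct_projective (X : Type) (V : X -> rmodType R) (M : rmodType R)
    (i : forall x, {linear V x -> M}) :
  coproduct i -> (forall x, projective (V x)) -> projective M.
Proof.
move=> [gen up] prV A B g f gS.
pose h x := sval (cid (prV x A B g (f \o i x : {linear _ -> _}) gS)).
have hE x v : g (h x v) = f (i x v).
  exact: (svalP (cid (prV x A B g (f \o i x : {linear _ -> _}) gS))).
have [k kE] := up A h; exists k.
apply: (@generating_ext _ _ _ i _ (g \o k : {linear _ -> _}) f gen) => x v /=.
by rewrite kE hE.
Qed.

Lemma coproduct_unique (X Y : Type) (V : rmodType R) (M N : rmodType R)
    (i : X -> {linear V -> M}) (j : Y -> {linear V -> N}) (f : X -> Y) :
  bijective f -> coproduct i -> coproduct j -> isomorphic M N.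
Proof.
move=> [g fK gK] [geni upi] [genj upj].
have [h hE] := upi N (fun x => j (f x)).
have [k kE] := upj M (fun y => i (g y)).
apply: (@iso_of_inverse _ _ _ h k).
  apply: (@generating_ext _ _ _ i _ (k \o h : {linear _ -> _}) idfun geni) => x v /=.
  by rewrite hE kE fK.
apply: (@generating_ext _ _ _ j _ (h \o k : {linear _ -> _}) idfun genj) => x v /=.
by rewrite kE hE gK.
Qed.

Lemma coproduct_comp (X Y : Type) (V M N : rmodType R)
    (i : X -> {linear V -> M}) (j : Y -> {linear M -> N}) :
  coproduct i -> coproduct j ->
  coproduct (fun p : Y * X => j p.1 \o i p.2 : {linear V -> N}).
Proof.
move=> [geni upi] [genj upj]; split.
  move=> n; elim: {n} (genj n) => [|y m n _ _ IH]; first exact: spanned0.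
  apply: spanned_add IH; elim: {m} (geni m) => [|x v m _ _ IH].
    by rewrite raddf0; exact: spanned0.
  rewrite linearD; apply: spanned_add IH.
  exact: (@spanned_gen _ _ _ (fun p : Y * X => j p.1 \o i p.2 : {linear V -> N}) setT (y, x)).
move=> P f.
pose h y := sval (cid (upi P (fun x => f (y, x)))).
have hE y x v : h y (i x v) = f (y, x) v := svalP (cid (upi P (fun x => f (y, x)))) x v.
have [k kE] := upj P h; exists k => -[y x] v /=.
by rewrite kE hE.
Qed.

(** * Direct sums of copies of one module *)

Section Fsupp.
Variables (X : Type) (V : rmodType R).

Definition single (x : X) (v : V) : X -> V := fun y => if `[< y = x >] then v else 0.

Lemma single_linear x : linear (single x).
Proof.
move=> a v w; apply/funext => y; rewrite /single.
by rewrite addrfctE scalrfctE; case: ifP => // _; rewrite scaler0 addr0.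
Qed.
HB.instance Definition _ x :=
  GRing.isLinear.Build R^c V (X -> V) *:%R (single x) (single_linear x).

Lemma finsupp_closed : submod_closed (bpred (spanned (fun x => single x : {linear V -> (X -> V)}) setT)).
Proof.
split=> [|a f g /bpredE sf /bpredE sg]; apply/bpredE; first exact: spanned0.
exact: spanned_linear.
Qed.

(** The functions of finite support, obtained as the span of the functions [single x v] in the full
    product. *)
Definition dsum : rmodType R := subm (mk_submod finsupp_closed).

Lemma exists_dsum_inj x : exists f : {linear V -> dsum}, forall v, val (f v) = single x v.
Proof.
apply: exists_restrict => v; apply/bpredE.
exact: (@spanned_gen _ _ _ (fun x => single x : {linear V -> (X -> V)})).
Qed.

Definition dsum_inj x : {linear V -> dsum} := sval (cid (exists_dsum_inj x)).

Lemma dsum_injE x v : val (dsum_inj x v) = single x v.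
Proof. exact: (svalP (cid (exists_dsum_inj x))). Qed.

Lemma dsum_coproduct : coproduct dsum_inj.
Proof.
have wo := svalP (@well_ordering_principle {classic X}).
apply: (@independent_coproduct X _ _ _ (sval (@well_ordering_principle {classic X})) wo).
  case=> f fP; have /bpredE sf := fP; suff [g sg gf] :
      exists2 g : dsum, spanned dsum_inj setT g & val g = f.
    by have <- : g = exist _ f fP by exact: val_inj.
  elim: sf => [|x v g _ _ [h sh <-]]; first by exists 0; [exact: spanned0|].
  by exists (dsum_inj x v + h); [exact: spannedD|rewrite linearD /= dsum_injE].
(* Evaluation at [x] kills the terms of index below [x] and returns [v] on the term at [x]. *)
move=> x v sp; have : val (dsum_inj x v) x = 0.
  elim: sp => // y w m yx _; rewrite linearD /= addrfctE => ->.
  rewrite dsum_injE addr0 /single; case: asboolP => // xy; subst y.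
  by have := wlt_irr wo yx.
by rewrite dsum_injE /single asboolT.
Qed.

End Fsupp.

Lemma dsum_iso (X Y : Type) (V : rmodType R) (f : X -> Y) :
  bijective f -> isomorphic (dsum X V) (dsum Y V).
Proof. by move=> fB; apply: coproduct_unique fB (dsum_coproduct _ _) (dsum_coproduct _ _). Qed.

Lemma dsum_dsum (X Y : Type) (V : rmodType R) :
  isomorphic (dsum Y (dsum X V)) (dsum (Y * X) V).
Proof.
have bij : bijective (@id (Y * X)) by exists id.
exact: coproduct_unique bij (coproduct_comp (dsum_coproduct _ _) (dsum_coproduct _ _))
  (dsum_coproduct _ _).
Qed.

Lemma dsum_iso_r (X : Type) (V W : rmodType R) :
  isomorphic V W -> isomorphic (dsum X V) (dsum X W).
Proof.
move=> /iso_inverse[f [g [fK gK]]].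
have [genV upV] := dsum_coproduct X V; have [genW upW] := dsum_coproduct X W.
have [h hE] := upV _ (fun x => dsum_inj W x \o f : {linear _ -> _}).
have [k kE] := upW _ (fun x => dsum_inj V x \o g : {linear _ -> _}).
apply: (@iso_of_inverse _ _ _ h k).
  apply: (@generating_ext _ _ _ _ _ (k \o h : {linear _ -> _}) idfun genV) => x v /=.
  by rewrite hE /= kE /= fK.
apply: (@generating_ext _ _ _ _ _ (h \o k : {linear _ -> _}) idfun genW) => x v /=.
by rewrite kE /= hE /= gK.
Qed.

Lemma pair_split (M N : rmodType R) (x : M) (y : N) :
  (x, y) = inl_lin N x + inr_lin M y.
Proof. by congr pair; rewrite /= ?addr0 ?add0r. Qed.

(* Hilbert's hotel: shifting the copies of [P] makes room for one more. *)
Lemma swindle (P Q : rmodType R) :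
  isomorphic (P * dsum nat (P * Q)%type)%type (dsum nat (P * Q)%type).
Proof.
set E := dsum nat _.
have [gen up] := dsum_coproduct nat (P * Q)%type.
pose j k : {linear _ -> E} := dsum_inj (P * Q)%type k.
pose a : {linear (P * Q)%type -> (P * Q)%type} := @inl_lin _ P Q \o fst.
pose b : {linear (P * Q)%type -> (P * Q)%type} := @inr_lin _ P Q \o snd.
(* [s] moves the [P]-component of each copy to the next copy and fixes the [Q]-components; [h] then
   puts the additional [P] in copy 0. *)
have [s sE] := up E (fun k => (j k.+1 \o a) \+ (j k \o b) : {linear _ -> _}).
pose h : {linear (P * E)%type -> E} := copair (j 0%N \o @inl_lin _ P Q : {linear _ -> _}) s.
(* The inverse moves [P]-components one copy down, that of copy 0 going to the additional [P]. *)
pose t1 k : {linear (P * Q)%type -> P} := if k is 0 then fst else \0.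
pose t2 k : {linear (P * Q)%type -> E} := if k is k'.+1 then j k' \o a else \0.
pose t k : {linear (P * Q)%type -> (P * E)%type} :=
  pairing (t1 k) (t2 k \+ (j k \o b) : {linear _ -> _}).
have [k kE] := up _ t.
have inl0 : @inl_lin _ P Q 0 = 0 by [].
have inr0 : @inr_lin _ P Q 0 = 0 by [].
have sl n x : s (j n (@inl_lin _ P Q x)) = j n.+1 (@inl_lin _ P Q x).
  by rewrite sE /= inr0 raddf0 addr0.
have sr n y : s (j n (@inr_lin _ P Q y)) = j n (@inr_lin _ P Q y).
  by rewrite sE /= inl0 raddf0 add0r.
have t1r n y : t1 n (@inr_lin _ P Q y) = 0 by case: n.
have t2r n y : t2 n (@inr_lin _ P Q y) = 0.
  by case: n => [//|n] /=; rewrite inl0 raddf0.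
apply: (@iso_of_inverse _ _ _ h k).
  have ks w : k (s w) = @inr_lin _ P E w.
    apply: (@generating_ext _ _ _ _ _ (k \o s : {linear _ -> _}) (@inr_lin _ P E) gen) => n [x y].
    rewrite /= pair_split !linearD -/(j n) sl sr !kE /t /= /pairing /= t1r t2r inr0 raddf0 add0r addr0.
    by congr pair; rewrite /= addr0.
  move=> [x w]; rewrite /h /= /copair linearD /= ks kE /t /= /pairing /=.
  by rewrite inr0 raddf0 addr0 [RHS]pair_split.
apply: (@generating_ext _ _ _ _ _ (h \o k : {linear _ -> _}) idfun gen) => n [x y] /=.
rewrite kE /h /= /copair /t /= /pairing /= linearD sr pair_split !linearD -/(j n).
rewrite t1r t2r !raddf0 !addr0.
case: n => [|n] /=; first by rewrite raddf0 add0r.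
by rewrite inl0 raddf0 add0r sl.
Qed.

End Coproducts.

(** * Vanishing of Ext *)

Section ExtClasses.
Variable R : pzRingType.

Lemma projective_regular : projective (R^c^o : rmodType R).
Proof.
move=> M N g f gS; have [m gm] := gS (f 1).
have hl : linear (fun r : R^c^o => r *: m : M).
  by move=> a x y; rewrite scalerDl -scalerA.
exists (mk_linear hl) => x; rewrite /= linearZ gm -linearZ; congr (f _).
exact: mulr1.
Qed.

Definition free_mod (X : Type) : rmodType R := dsum X (R^c^o : rmodType R).

Lemma projective_dsum (X : Type) (P : rmodType R) : projective P -> projective (dsum X P).
Proof. by move=> prP; apply: coproduct_projective (dsum_coproduct X P) _. Qed.

Lemma projective_free (X : Type) : projective (free_mod X).
Proof. exact/projective_dsum/projective_regular. Qed.

(** A contracting homotopy, built degree by degree from a section of the augmentation: [1 - s d]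
    takes its values in a kernel, which is the image of the next differential, and therefore
    lifts. *)
Lemma resolution_homotopy (M : rmodType R) (P : proj_resolution M) n : projective M ->
  exists s : {linear res_obj P n -> res_obj P n.+1},
    forall x, res_d P n (s (res_d P n x)) = res_d P n x.
Proof.
move=> prM; elim: n => [|n [s sP]].
  have [t tP] := prM _ _ (res_aug P) idfun (@res_aug_surj _ _ P).
  have [|s sE] := projective_lift (g := res_d P 0)
    (f := idfun \- (t \o res_aug P) : {linear _ -> _}) (@res_projective _ _ P 0).
    by move=> x; apply/res_exact0; rewrite /= linearB /= tP subrr.
  exists s => x; rewrite sE /=; have /res_exact0 -> : exists y, res_d P 0 y = res_d P 0 x by exists x.
  by rewrite raddf0 subr0.
have [|t tE] := projective_lift (g := res_d P n.+1)
  (f := idfun \- (s \o res_d P n) : {linear _ -> _}) (@res_projective _ _ P n.+1).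
  by move=> x; apply/res_exact; rewrite /= linearB /= sP subrr.
exists t => x; rewrite tE /=.
have /res_exact -> : exists y, res_d P n.+1 y = res_d P n.+1 x by exists x.
by rewrite raddf0 subr0.
Qed.

(** A cocycle [f] vanishes on boundaries, and each [x - s (d x)] is a boundary; hence [f] is [f s]
    composed with [d]. *)
Lemma projective_perp_inf (C : modclass R) (M : rmodType R) :
  projective M -> perp_inf C M.
Proof.
move=> prM [//|n] N _ _ P f fd; have [s sP] := resolution_homotopy P n prM.
exists (f \o s : {linear _ -> _}) => x /=.
apply/eqP; rewrite -subr_eq0 -linearB; apply/eqP.
have /res_exact[y <-] : res_d P n (x - s (res_d P n x)) = 0.
  by rewrite linearB /= sP subrr.
exact: fd.
Qed.

Section AddProjective.
Variables (N F : rmodType R) (P : proj_resolution (N * F)%type).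
Hypothesis prF : projective F.
Variable s : {linear F -> res_obj P 0}.
Hypothesis sE : forall y, res_aug P (s y) = (0, y).

Definition cut_obj n : rmodType R :=
  match n with 0 => res_obj P 0 | 1 => (res_obj P 1 * F)%type | n => res_obj P n end.

Definition cut_d n : {linear cut_obj n.+1 -> cut_obj n} :=
  match n with
  | 0 => copair (res_d P 0) s
  | 1 => @inl_lin _ _ F \o res_d P 1
  | n => res_d P n
  end.

Definition cut_aug : {linear cut_obj 0 -> N} := fst \o res_aug P.

(* Moving [F] from degree -1 to degree 1 turns a resolution of [N * F] into one of [N]. *)
Definition cut_resolution : proj_resolution N.
Proof.
apply: (@ProjResolution R N cut_obj cut_d cut_aug).
- case=> [|[|n]] /=; try exact: res_projective.
  by apply: projective_prod => //; exact: res_projective.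
- by move=> y; have [x xE] := res_aug_surj P (y, 0); exists x; rewrite /cut_aug /= xE.
- move=> x; rewrite /cut_aug /=; split=> [x0|[[p y] <-]].
    have /res_exact0[p pE] : res_aug P (x - s (res_aug P x).2) = 0.
      by rewrite linearB /= sE; case: (res_aug P x) x0 => a b /= ->; rewrite subrr.
    by exists (p, (res_aug P x).2); rewrite /copair /= pE subrK.
  rewrite /copair linearD /= sE addr0.
  by have /res_exact0 -> : exists q, res_d P 0 q = res_d P 0 p by exists p.
- case=> [|[|n]] x /=.
  + case: x => p y; rewrite /copair /=; split=> [e|[z [<- <-]]]; last first.
      by rewrite raddf0 addr0; apply/res_exact; exists z.
    have y0 : y = 0.
      have := congr1 (res_aug P) e; rewrite linearD /= sE raddf0.
      have /res_exact0 -> : exists q, res_d P 0 q = res_d P 0 p by exists p.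
      by rewrite add0r => -[].
    move: e; rewrite y0 raddf0 addr0 => /res_exact[z <-].
    by exists z.
  + rewrite /inl_lin; split=> [[]|/res_exact ->] //.
    by move=> /res_exact.
  + exact: res_exact.
Defined.

End AddProjective.

(** Since [Ext_vanishes] concerns every resolution, an arbitrary one of [N * F] is converted into
    one of [N]. Only degree 1 gains a summand [F]: cocycles there are extended by 0 on [F], and a
    cochain found there is restricted to the first factor. *)
Lemma perp_inf_add_projective (C : modclass R) (N F : rmodType R) :
  projective F -> perp_inf C N -> perp_inf C (N * F)%type.
Proof.
move=> prF perpN i K i0 CK P.
have [s sE] := prF _ _ (res_aug P) (@inr_lin _ N F) (@res_aug_surj _ _ P).
have := perpN i K i0 CK (cut_resolution prF sE).
case: i i0 => [//|[|[|n]]] _ /= van f fd.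
- have [|g gE] := van (copair f \0 : {linear _ -> _}).
    by move=> x; rewrite /= /copair /= fd addr0.
  exists g => x; have := gE (x, 0).
  by rewrite /= /copair /= !raddf0 !addr0.
- have [|g gE] := van f; first exact: fd.
  by exists (g \o @inl_lin _ _ F : {linear _ -> _}).
- exact: van.
Qed.

End ExtClasses.

(** * Decomposition of the modules of a categorical class *)

Lemma index_injects_dsum (R : pzRingType) (X : Type) (P : rmodType R) (v : P) :
  v != 0 -> injects X (dsum X P).
Proof.
move=> v0; exists (fun x => dsum_inj P x v) => x y /(congr1 val).
rewrite !dsum_injE => /(congr1 (fun f : X -> P => f x)); rewrite /single (asboolT (erefl x)).
by case: asboolP => // _ e; rewrite e eqxx in v0.
Qed.

Lemma dsum_injects (R : pzRingType) (X Z : Type) (P : rmodType R) :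
  injects nat Z -> injects X Z -> injects P Z -> injects (dsum X P) Z.
Proof.
move=> natZ XZ PZ; have [gen _] := dsum_coproduct X P.
exact: generating_injects natZ XZ _ gen.
Qed.

(** As [nat * X] and [X] are equipotent, the free module is a countable sum of copies of itself,
    that is of [P * Q], and the swindle absorbs [P]. *)
Lemma free_absorb (R : pzRingType) (X : cardinal) (P Q : rmodType R) :
  injects nat X -> isomorphic (free_mod R X) (P * Q)%type ->
  isomorphic (P * free_mod R X)%type (free_mod R X).
Proof.
move=> natX FPQ.
have [f fB] : exists f : nat * X -> X, bijective f.
  apply/ceq_bij/ceq_injects; split; first exact (prod_injects natX natX (injects_refl X)).
  by exists (fun x => (0%N, x)) => x y [].
have FF : isomorphic (free_mod R X) (dsum nat (P * Q)%type).
  apply: iso_trans (dsum_iso_r nat FPQ); apply: iso_sym.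
  exact: iso_trans (dsum_dsum _ _ _) (dsum_iso _ fB).
apply: iso_trans (iso_sym FF); apply: iso_trans (swindle P Q).
exact: iso_prod (iso_refl P) FF.
Qed.

Lemma iso_swap (R : pzRingType) (M N : rmodType R) : isomorphic (M * N)%type (N * M)%type.
Proof.
by apply: (@iso_of_inverse _ _ _ (pairing snd fst : {linear _ -> _})
  (pairing snd fst : {linear _ -> _})) => -[].
Qed.

Lemma iso_assoc (R : pzRingType) (M N P : rmodType R) :
  isomorphic ((M * N) * P)%type (M * (N * P))%type.
Proof.
by apply: (@iso_of_inverse _ _ _
  (pairing (fst \o fst : {linear _ -> _})
    (pairing (snd \o fst : {linear _ -> _}) snd) : {linear _ -> _})
  (pairing (pairing fst (fst \o snd : {linear _ -> _}) : {linear _ -> _})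
    (snd \o snd : {linear _ -> _}) : {linear _ -> _})) => [[[]]|[? []]].
Qed.

Lemma projective_free_summand (R : pzRingType) (M : rmodType R) : projective M ->
  exists N : rmodType R, isomorphic (free_mod R M) (M * N)%type.
Proof.
move=> prM; have [_ up] := dsum_coproduct M (R^c^o : rmodType R).
have act m : linear (fun r : R^c^o => r *: m : M).
  by move=> a x y; rewrite scalerDl -scalerA.
have [h hE] := up M (fun m => mk_linear (act m)).
apply: (projective_summand (g := h)) => // m.
by exists (dsum_inj (R^c^o : rmodType R) m 1); rewrite hE /= scale1r.
Qed.

(** With [F] the free module of rank [M], the surjection gives [M = F * P], and projectivity gives
    [F = M * Q]. So [P] is a summand of [F], and [F] absorbs it. *)
Lemma free_of_free_quotient (R : pzRingType) (M : rmodType R) (h : {linear M -> free_mod R M}) :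
  injects nat M -> projective M -> (forall y, exists x, h x = y) ->
  isomorphic M (free_mod R M).
Proof.
move=> natM prM hS.
have [P MP] := projective_summand (@projective_free R M) hS.
have [Q FQ] := projective_free_summand prM.
apply: (iso_trans MP); apply: (iso_trans (iso_swap _ _)).
apply: (free_absorb (Q := (free_mod R M * Q)%type)) => //.
apply: (iso_trans FQ); apply: iso_trans (iso_prod MP (iso_refl Q)) _.
apply: iso_trans (iso_prod (iso_swap _ _) (iso_refl Q)) _.
exact: iso_assoc.
Qed.

Lemma wo_intro (T : Type) (le : rel T) :
  (forall x y, le x y -> le y x -> x = y) ->
  (forall (P : set T) x, P x -> exists2 z, P z & forall y, P y -> le z y) ->
  well_order le.
Proof.
move=> anti lemin A [x Ax]; have [z Az zmin] := lemin (fun x => x \in A) x Ax.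
exists z; split=> [|t [At tmin]]; first by split=> // y; exact: zmin.
by apply: anti; [exact: zmin|exact: tmin].
Qed.

(** * Small modules of a categorical class *)

Section Categoricity.
Variables (R : pzRingType) (D : modclass R) (prec : strongrel R) (C : modclass R).
Variables (rho lam : cardinal).
Hypothesis DE : forall M, D M <-> perp_inf C M.
Hypothesis precE : forall (M : rmodType R) (A : submodClosed M), prec A <-> ext_prec D A.
Hypothesis aec : is_AEC D prec.
Hypothesis LS : LS_property D prec rho.
Hypothesis nat_rho : injects nat rho.
Hypothesis R_rho : injects R rho.
Hypothesis rho_lam : injects rho lam.
Hypothesis cat_lam : categorical D lam.

Let D_iso M N : isomorphic M N -> D M -> D N := @AEC_class_iso _ _ _ aec M N.

Let nat_lam : injects nat lam := injects_trans nat_rho rho_lam.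

Let D_projective M : projective M -> D M.
Proof. by move=> prM; apply/DE; exact: projective_perp_inf. Qed.

Let D_prod M P : projective P -> D M -> D (M * P)%type.
Proof. by move=> prP /DE DM; apply/DE; exact: perp_inf_add_projective. Qed.

(** Over the zero ring every module is zero, whereas categoricity provides an infinite one. *)
Lemma ring_nontrivial : (1 : R^c^o : rmodType R) != 0.
Proof.
have [[M [_ /ceq_injects[_ lamM]]] _] := cat_lam.
apply/eqP => e; have [f fI] := injects_trans nat_lam lamM.
by have /fI : f 0%N = f 1%N by rewrite -[LHS]scale1r -[RHS]scale1r (e : 1 = 0 :> R^c) !scale0r.
Qed.

Lemma free_cardinal (X : cardinal) : injects rho X -> ceq (free_mod R X) X.
Proof.
move=> rhoX; apply/ceq_injects; split; last exact: index_injects_dsum ring_nontrivial.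
apply: dsum_injects; [exact: injects_trans rhoX|exact: injects_refl|].
exact: injects_trans R_rho rhoX.
Qed.

Lemma iso_free_lam M : D M -> injects M lam -> injects lam M -> isomorphic M (free_mod R lam).
Proof.
move=> DM Mlam lamM; have [_ uniq] := cat_lam; apply: uniq => //.
- exact/D_projective/projective_free.
- exact/ceq_injects.
- exact: free_cardinal.
Qed.

Lemma small_projective M : D M -> injects M lam -> projective M.
Proof.
move=> DM Mlam; have /ceq_injects[Flam lamF] := free_cardinal rho_lam.
have iso : isomorphic (M * free_mod R lam)%type (free_mod R lam).
  apply: iso_free_lam; first by apply: D_prod => //; exact: projective_free.
    exact: prod_injects.
  apply: injects_trans lamF _.
  by exists (@inr_lin R M (free_mod R lam)) => x y [].
have prMF := projective_iso (iso_sym iso) (@projective_free R lam).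
by apply: (projective_retract (i := @inl_lin R M (free_mod R lam)) (p := fst)) prMF.
Qed.

Lemma small_generator (Q : rmodType R) (v : Q) : D Q -> injects Q lam -> v != 0 ->
  exists r : seq R^c^o, \sum_(a <- r) a = 1 /\
    forall k, (k < size r)%N -> exists (f : {linear Q -> R^c^o}) x, f x = r`_k.
Proof.
move=> DQ Qlam v0; have prQ := small_projective DQ Qlam.
have [f [g [fK gK]]] : exists (f : {linear dsum lam Q -> free_mod R lam})
    (g : {linear free_mod R lam -> dsum lam Q}), cancel f g /\ cancel g f.
  apply/iso_inverse/iso_free_lam.
  - exact/D_projective/projective_dsum.
  - exact: dsum_injects nat_lam (injects_refl lam) Qlam.
  - exact: index_injects_dsum v0.
have [l _] := nat_lam; pose x0 := l 0%N.
have [gen _] := dsum_coproduct lam Q.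
have [_ up] := dsum_coproduct lam (R^c^o : rmodType R).
(* [h] adds up the coordinates. It takes a basis vector to 1, and the preimage of that vector under
   [f] is a finite sum of elements from copies of [Q]. *)
have [h hE] := up (R^c^o : rmodType R) (fun _ => idfun).
have [s sE] := spanned_seq (g (dsum_inj (R^c^o : rmodType R) x0 1)) gen.
pose t (p : {_ : lam & Q}) := h (f (dsum_inj Q (tag p) (tagged p))).
exists (map t s); split.
  rewrite big_map -[RHS](hE x0 1) /= -[dsum_inj (R^c^o : rmodType R) x0 1]gK sE.
  rewrite (linear_sum f) (linear_sum h).
  exact: eq_bigr.
move=> k; rewrite size_map => ks.
have p0 : {_ : lam & Q} := Tagged (fun _ => Q) (i := x0) v.
rewrite (nth_map p0) //; set p := nth _ _ _.
by exists (h \o (f \o dsum_inj Q (tag p) : {linear _ -> _}) : {linear _ -> _}), (tagged p).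
Qed.

(** The Loewenheim-Skolem property in [M/A] encloses the class of [y] in a strong submodule [B] of
    size at most [rho]. Being projective, [B] lifts to [M] through [s], and the preimage of [B] is
    the direct sum of [A] and the image of [s]. *)
Lemma split_step (M : rmodType R) (A : submodClosed M) (y : M) : prec A ->
  exists (V : rmodType R) (s : {linear V -> M}),
    [/\ D V, injects V rho, forall v, s v \in A -> v = 0 &
      exists B : submodClosed M, [/\ prec B, y \in B &
        forall x, x \in B <-> exists a v, a \in A /\ x = a + s v]].
Proof.
move=> /precE[DA DM DMA].
(* [Y] is cyclic, hence no larger than [R]. *)
have [||Y YE] := @exists_submod _ (quotm A) (fun c => exists r : R^c, c = r *: quotm_pi A y).
- by exists 0; rewrite scale0r.
- by move=> a _ _ [r ->] [r' ->]; exists (a * r + r'); rewrite scalerDl scalerA.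
have [B [YB DB /precE[_ _ DMB] /cleP Brho]] := LS Y DMA.
have {}Brho : injects (subm B) rho.
  apply: injects_trans Brho _; apply: sum_injects => //; last exact: injects_refl.
  apply: injects_trans R_rho.
  have /choice[r rE] (c : subm Y) : exists r : R^c, val c = r *: quotm_pi A y.
    exact/YE/(valP c).
  by exists r => c c' e; apply: val_inj; rewrite !rE e.
have prB := small_projective DB (injects_trans Brho rho_lam).
have [|s sE] := projective_lift (g := quotm_pi A) (f := (val : {linear subm B -> quotm A})) prB.
  by move=> x; exact: quotm_pi_surj.
have [||B' B'E] := @exists_submod _ M (fun x => quotm_pi A x \in B).
- by rewrite raddf0 rpred0.
- by move=> a x x' xB x'B; rewrite linearP rpredD // rpredZ.
have sA v : s v \in A -> v = 0.
  by move=> /quotm_pi_eq0; rewrite sE => v0; exact: val_inj.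
have B'sum x : x \in B' <-> exists a v, a \in A /\ x = a + s v.
  rewrite B'E; split=> [xB|[a [v [/quotm_pi_eq0 aA ->]]]]; last first.
    by rewrite linearD /= aA add0r sE; exact: (valP v).
  pose v : subm B := exist (fun z => z \in B) (quotm_pi A x) xB.
  exists (x - s v), v; rewrite subrK; split=> //.
  by apply/quotm_pi_eq0; rewrite linearB /= sE /= subrr.
exists (subm B), s; split=> //; exists B'; split=> //; last first.
  by apply/B'E/YB/YE; exists 1; rewrite scale1r.
apply/precE; split=> //.
(* The sum of [A] and a projective module is in [D]. *)
- have [|h hE] := @exists_restrict _ _ _ (copair (val : {linear subm A -> M}) s : {linear _ -> _}) B'.
    by case=> a v; apply/B'sum; exists (val a), v; split=> //; exact: (valP a).
  apply: D_iso (D_prod prB DA); apply: (@iso_inj_surj _ _ _ h).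
    move=> [a v] /(congr1 val); rewrite hE /= /copair /= => e.
    have v0 : v = 0.
      apply: sA; have -> : s v = -1 *: val a.
        by rewrite scaleN1r; apply/eqP; rewrite -addr_eq0 addrC e.
      by rewrite rpredZ //; exact: (valP a).
    move: e; rewrite v0 raddf0 addr0 => a0.
    by congr (_, _); exact: val_inj.
  move=> [x xB']; have /B'sum[a [v [aA xE]]] := xB'.
  exists ((exist (fun z => z \in A) a aA : subm A), v).
  by apply: val_inj; rewrite hE; exact: esym xE.
(* [M/B'] is isomorphic to [(M/A)/B]. *)
apply: D_iso DMB.
apply: (@iso_same_kernel _ M _ _ (quotm_pi B \o quotm_pi A : {linear _ -> _}) (quotm_pi B')).
- move=> z; have [w <-] := quotm_pi_surj z; have [x <-] := quotm_pi_surj w.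
  by exists x.
- exact: quotm_pi_surj.
- by move=> x; rewrite /= !quotm_pi_eq0 B'E.
Qed.

(** * Filtration of a module of the class *)

Section Filtration.
Variable M : rmodType R.
Hypothesis DM : D M.

(** Stated for subsets, which allow the stages to be defined by recursion and compared by
    extensionality. *)
Definition strong (S : set M) : Prop :=
  exists2 A : submodClosed M, prec A & forall x, x \in A <-> S x.

Definition extension := {V : rmodType R & {linear V -> M}}.

Definition extended (S : set M) (e : extension) : set M :=
  [set x | exists a v, S a /\ x = a + tagged e v].

Lemma exists_extension (S : set M) (y : M) : exists e : extension, strong S ->
  [/\ D (tag e), injects (tag e) rho, forall v, S (tagged e v) -> v = 0,
      strong (extended S e) & extended S e y].
Proof.
have [[A pA AE]|nS] := pselect (strong S); last first.
  (* A default value, which makes [next] a total function. *)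
  by exists (existT (fun V : rmodType R => {linear V -> M}) M idfun) => /nS.
have [V [s [DV Vrho sA [B [pB yB BE]]]]] := split_step y pA.
exists (existT (fun V : rmodType R => {linear V -> M}) V s) => _.
have BE' x : x \in B <-> extended S (existT (fun V : rmodType R => {linear V -> M}) V s) x.
  by rewrite BE; split=> -[a [v [/AE aA ->]]]; exists a, v.
split=> //; [by move=> v /AE/sA|by exists B|exact/BE'].
Qed.

Definition next S y : extension := sval (cid (exists_extension S y)).

Lemma nextP S y : strong S ->
  [/\ D (tag (next S y)), injects (tag (next S y)) rho,
      forall v, S (tagged (next S y) v) -> v = 0,
      strong (extended S (next S y)) & extended S (next S y) y].
Proof. exact: (svalP (cid (exists_extension S y))). Qed.

Lemma sub_extended S e : S `<=` extended S e.
Proof. by move=> a Sa; exists a, 0; rewrite raddf0 addr0. Qed.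

Lemma strong0 : strong [set 0].
Proof.
have [||A AE] := @exists_submod _ M (fun x => x = 0) => //.
  by move=> a x y -> ->; rewrite scaler0 addr0.
exists A => //; apply/precE; split=> //.
  have A0 (x : subm A) : x = 0 by apply: val_inj; apply/AE; exact: (valP x).
  apply: D_projective => P N g f _; exists \0 => x.
  by rewrite (A0 x) !raddf0.
apply: D_iso DM; apply: iso_sym.
by apply: (@iso_same_kernel _ M _ _ (quotm_pi A) idfun) => [|y|x];
  [exact: quotm_pi_surj|exists y|rewrite quotm_pi_eq0 AE].
Qed.

Lemma strong_linear S a x y : strong S -> S x -> S y -> S (a *: x + y).
Proof. by move=> [A _ AE] /AE xA /AE yA; apply/AE; rewrite rpredD // rpredZ. Qed.

Lemma strong_has0 S : strong S -> S 0.
Proof. by move=> [A _ AE]; apply/AE; rewrite rpred0. Qed.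

Section Chain.
Variables (X : cardinal) (le : rel X) (S : X -> set M).
Hypothesis wo : well_order le.
Hypothesis Sstrong : forall x, strong (S x).
Hypothesis Smono : forall x y, le x y -> S x `<=` S y.
Hypothesis Slim : forall x, is_limit le x -> S x `<=` \bigcup_(y in wbelow le x) S y.

Lemma strong_chain (x0 : X) : strong (\bigcup_x S x).
Proof.
pose A x : submodClosed M := s2val (cid2 (Sstrong x)).
have pA x : prec (A x) := s2valP (cid2 (Sstrong x)).
have AE x m : m \in A x <-> S x m := s2valP' (cid2 (Sstrong x)) m.
have [||U UE] := @exists_submod _ M (fun m => (\bigcup_x S x) m).
- by exists x0 => //; exact: strong_has0.
- move=> a m n [x _ Sm] [y _ Sn].
  have [xy|yx] := wo_total wo x y.
    by exists y => //; apply: strong_linear => //; exact: Smono Sm.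
  by exists x => //; apply: strong_linear => //; exact: Smono Sn.
exists U => //.
have DA x : D (subm (A x)) by have /precE[] := pA x.
have [|x|_ _] := @AEC_chain _ _ _ aec X le M A U.
- split=> // [x y [xy _]|x xlim m].
    (* Both members are strong in [M], so coherence makes the smaller one strong in the larger. *)
    apply: (AEC_coherence aec) => // m /AE Sm; apply/AE; apply: Smono Sm.
    exact: (wltW wo xy).
  split=> [/AE/(Slim xlim)[y yx /AE]|[y yx /AE Sm]]; first by exists y.
  by apply/AE; apply: Smono Sm; exact: (wltW wo yx).
- split=> [/UE[y _ /AE]|[y /AE Sm]]; first by exists y.
  by apply/UE; exists y.
- exact.
Qed.

End Chain.

(** [M] indexes its own filtration: the step at [x] adds [x] to what has been reached. *)
Let le : rel M := sval (@well_ordering_principle M).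
Let wo : well_order le := svalP (@well_ordering_principle M).

(** One formula covers the first, successor and limit stages: the union of 0 and of the extensions
    of all earlier stages. *)
Definition stage_body (x : M) (rec : forall y, wlt le y x -> set M) : set M :=
  [set m | m = 0 \/ exists y (yx : wlt le y x), extended (rec y yx) (next (rec y yx) y) m].

Definition stage : M -> set M := Fix (wlt_wf wo) (fun=> set M) stage_body.

Lemma stageE x : stage x =
  [set m | m = 0 \/ exists2 y, wlt le y x & extended (stage y) (next (stage y) y) m].
Proof.
rewrite /stage Fix_eq => [|y f g fg].
  rewrite predeqE /stage_body => m; split=> -[->|[y]]; (try by left).
    by move=> [yx H]; right; exists y.
  by move=> yx H; right; exists y, yx.
congr stage_body; apply: functional_extensionality_dep => z.
by apply: functional_extensionality_dep => zy; exact: fg.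
Qed.

Lemma stage_mono x y : le x y -> stage x `<=` stage y.
Proof.
move=> xy m; rewrite (stageE x) (stageE y) => -[->|[z zx H]]; [by left|right].
by exists z => //; exact (wlt_le_trans wo zx xy).
Qed.

Lemma stage_next x y : wlt le y x -> extended (stage y) (next (stage y) y) `<=` stage x.
Proof. by move=> yx m H; rewrite stageE; right; exists y. Qed.

Lemma stage_limit x : is_limit le x -> stage x `<=` \bigcup_(y in wbelow le x) stage y.
Proof.
move=> [[y0 y0x] nosucc] m; rewrite {1}stageE => -[->|[y yx H]].
  by exists y0 => //; rewrite stageE; left.
have [z zx yz] : exists2 z, wlt le z x & wlt le y z.
  apply: contrapT => nz; apply: nosucc; exists y; split=> // z zx.
  by apply: contrapT => /negP yz; apply: nz; exists z.
by exists z => //; exact: stage_next yz _ H.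
Qed.

Lemma strong_stage x : strong (stage x).
Proof.
elim/(well_founded_ind (wlt_wf wo)): x => x IH.
have [[y0 y0x]|nobelow] := pselect (exists y, wlt le y x); last first.
  rewrite (_ : stage x = [set 0]); first exact: strong0.
  rewrite stageE predeqE => m; split=> [[->//|[y yx]]|->]; last by left.
  by case: nobelow; exists y.
have [[y [yx ymax]]|nosucc] := pselect (exists y, is_succ le y x).
  rewrite (_ : stage x = extended (stage y) (next (stage y) y)).
    by have [] := nextP y (IH y yx).
  rewrite predeqE => m; split; last exact: stage_next.
  rewrite stageE => -[->|[z zx H]].
    by apply: sub_extended; exact: strong_has0 (IH y yx).
  have [zy|zy|yz] := wlt_or wo z y; [|by rewrite -zy|by have /wltNge[] := yz; exact: ymax].
  by apply: sub_extended; exact: stage_next zy _ H.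
(* At a limit, the chain axiom is applied to the predecessors of [x], taken as an index type of
   their own. *)
pose X := {y | wlt le y x}; pose leX : rel X := fun y z => le (sval y) (sval z).
have woX : well_order leX.
  apply: wo_intro => [y z yz zy|P y Py].
    by apply: sval_inj; exact: (wo_anti wo).
  have [u [z [Pz zu]] zmin] := @wo_min _ _ wo (fun u => exists z, P z /\ sval z = u) (sval y)
    (ex_intro _ y (conj Py erefl)).
  by exists z => // t Pt; rewrite /leX zu; apply: zmin; exists t.
rewrite (_ : stage x = \bigcup_(y : X) stage (sval y)); last first.
  rewrite predeqE => m; split=> [|[[y yx] _ /=]]; last exact: stage_mono (wltW wo yx) _.
  have lim : is_limit le x by split=> //; exists y0.
  by move=> /(stage_limit lim)[y yx ym]; exists (exist _ y yx).
apply: (@strong_chain X leX (fun y => stage (sval y)) woX) => //.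
- by move=> [y yx]; exact: IH.
- by move=> y z yz; exact: stage_mono.
(* A limit among the predecessors of [x] is also a limit in [M]. *)
- move=> [y yx] [[[z zx] zy] nosuccy] m /= ym.
  have [|u uy um] := @stage_limit y _ m ym.
    split; first by exists z.
    move=> [u [uy umax]]; apply: nosuccy.
    have ux : wlt le u x by exact (wlt_le_trans wo uy (wltW wo yx)).
    by exists (exist _ u ux); split=> // -[v vx] vy; exact: umax.
  have ux : wlt le u x by exact (wlt_le_trans wo uy (wltW wo yx)).
  by exists (exist _ u ux).
- by exists y0.
Qed.

(** The component at [x] is the complement added at that step. It meets [stage x], which contains
    all earlier components, trivially; and [x] itself lies in the sum reached after its step. *)
Lemma exists_decomposition :
  exists (V : M -> rmodType R) (i : forall x, {linear V x -> M}),
    coproduct i /\ forall x, D (V x) /\ injects (V x) rho.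
Proof.
pose e x := next (stage x) x; have eP x := nextP x (strong_stage x).
exists (fun x => tag (e x)), (fun x => tagged (e x)); split; last first.
  by move=> x; have [] := eP x.
apply: (independent_coproduct wo).
  have gen x m : stage x m -> spanned (fun x => tagged (e x)) setT m.
    elim/(well_founded_ind (wlt_wf wo)): x m => x IH m.
    rewrite stageE => -[->|[y yx [a [v [ya ->]]]]]; first exact: spanned0.
    apply: spanned_add; first exact: IH ya.
    exact: (spanned_gen (fun x => tagged (e x))).
  move=> m; have [_ _ _ _ [a [v [ma ->]]]] := eP m.
  apply: spanned_add; first exact: gen ma.
  exact: (spanned_gen (fun x => tagged (e x))).
move=> x v sv; have [_ _ + _ _] := eP x; apply.
elim: sv => [|y w m yx _ IH]; first exact: strong_has0 (strong_stage x).
have yw : stage x (tagged (e y) w).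
  apply: (stage_next yx); exists 0, w; split; last by rewrite add0r.
  exact: strong_has0 (strong_stage y).
by have := strong_linear 1 (strong_stage x) yw IH; rewrite scale1r.
Qed.

End Filtration.

Lemma D_only_projective M : D M -> projective M.
Proof.
move=> /exists_decomposition[V [i [cop iV]]]; apply: coproduct_projective cop _ => x.
have [DV Vrho] := iV x; apply: small_projective DV _.
exact: injects_trans rho_lam.
Qed.

End Categoricity.

(** * Large direct sums of generators *)

Section LargeCoproduct.
Variables (R : pzRingType) (X : cardinal) (V : X -> rmodType R) (M : rmodType R).
Variable i : forall x, {linear V x -> M}.
Variable rho : cardinal.
Hypothesis cop : coproduct i.
Hypothesis nat_rho : injects nat rho.
Hypothesis R_rho : injects R rho.
Hypothesis V_rho : forall x, injects (V x) rho.
Hypothesis large : ~ injects M rho.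

Let K : rmodType R := R^c^o.

(* [1] lies in the trace ideal of [Q], as a sum of the values [r] of functionals. *)
Definition represents (Q : rmodType R) (r : seq K) : Prop :=
  \sum_(a <- r) a = 1 /\
  forall k, (k < size r)%N -> exists (f : {linear Q -> K}) u, f u = r`_k.

Let I : set X := fun x => exists v : V x, v != 0.

Hypothesis gen : forall x, I x -> exists r, represents (V x) r.

Let exists_rep x : exists r, I x -> represents (V x) r.
Proof.
have [/gen[r rP]|nI] := pselect (I x); first by exists r.
by exists [::] => /nI.
Qed.

Let rep x : seq K := sval (cid (exists_rep x)).

Let repP x : I x -> represents (V x) (rep x).
Proof. exact: (svalP (cid (exists_rep x))). Qed.

Let class (s : seq K) : set X := fun x => I x /\ rep x = s.

Let big : set X := fun x => I x /\ injects nat {y | class (rep x) y}.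

(** An infinite class is equipotent with its product by [nat]; this gives each of its elements [x] a
    sequence [g x] in the class, with disjoint sequences for distinct elements. *)
Let exists_split s : exists g : X -> nat -> X, injects nat {y | class s y} ->
  (forall x n, class s x -> class s (g x n)) /\
  (forall x y n k, class s x -> class s y -> g x n = g y k -> x = y /\ n = k).
Proof.
have [inf|ninf] := pselect (injects nat {y | class s y}); last by exists (fun x _ => x) => /ninf.
have [p pI] := prod_injects inf (injects_refl _) inf.
exists (fun x n => if pselect (class s x) is left sx then sval (p (exist _ x sx, n)) else x).
move=> _; split=> [x n sx|x y n k sx sy].
  by case: pselect => // {}sx; exact: (svalP (p _)).
by case: pselect => // {}sx; case: pselect => // {}sy /sval_inj/pI[].
Qed.

Let split_map s := sval (cid (exists_split s)).

(* The block of [x] consists of the indices [theta x n] for [n < size (rep x)]. *)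
Let theta (x : X) n : X := split_map (rep x) x n.

Let theta_class x n : big x -> I (theta x n) /\ rep (theta x n) = rep x.
Proof.
move=> [Ix inf]; have [h _] := svalP (cid (exists_split (rep x))) inf.
exact: h.
Qed.

Let theta_inj x y n k : big x -> big y -> theta x n = theta y k -> x = y /\ n = k.
Proof.
move=> bx b_y e; have [_ rx] := theta_class n bx; have [_ ry] := theta_class k b_y.
have rxy : rep x = rep y by rewrite -rx e ry.
have [Ix inf] := bx; have [Iy _] := b_y.
have [_ h] := svalP (cid (exists_split (rep x))) inf.
by apply: h => //; move: e; rewrite /theta -rxy.
Qed.

Let T : cardinal := {x | big x}.

(** If [z] is the index of rank [n] in the block of [t], a functional taking the value [r_n] is
    composed with the inclusion of coordinate [t]. Such [t] and [n] are unique by [theta_inj];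
    without them the map is 0. *)
Let exists_component z : exists l : {linear V z -> free_mod R T},
  forall (t : T) n, z = theta (sval t) n -> (n < size (rep (sval t)))%N ->
    exists u, l u = dsum_inj K t (rep (sval t))`_n.
Proof.
have [[[x bx] [n [zE ns]]]|none] := pselect (exists (t : T) n, z = theta (sval t) n /\
    (n < size (rep (sval t)))%N); last first.
  by exists \0 => t n zE ns; case: none; exists t, n.
subst z; have [Iz rz] := theta_class n bx.
have [_ /(_ n)] := repP Iz; rewrite rz => /(_ ns)[f [u fu]].
exists (dsum_inj K (exist _ x bx : T) \o f : {linear _ -> _}) => -[y b_y] k /= e ks.
have [xy nk] := theta_inj bx b_y e.
subst y k; exists u; rewrite /= fu; congr (dsum_inj K _ _).
exact: sval_inj.
Qed.

Lemma large_surjection :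
  exists h : {linear M -> free_mod R T}, forall y, exists x, h x = y.
Proof.
pose l z := sval (cid (exists_component z)).
have lP z := svalP (cid (exists_component z)).
have [_ up] := cop; have [h hE] := up _ l; exists h.
have [genF _] := dsum_coproduct T K.
move=> y; elim: {y} (genF y) => [|t a y _ _ [x xE]]; first by exists 0; rewrite raddf0.
suff [m mE] : exists m, h m = dsum_inj K t 1.
  exists (a *: m + x); rewrite linearP mE xE -linearZ; congr (dsum_inj K t _ + _).
  exact: mulr1.
(* The basis vector at [t] is the sum of the multiples by the [r_n], each attained on one index of
   the block. *)
have [sum1 _] := repP (svalP t).1; rewrite -[X in dsum_inj K t X]sum1.
rewrite (big_nth 0) big_mkord linear_sum.
elim/big_ind: _ => [|y1 y2 [m1 <-] [m2 <-]|n _].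
- by exists 0; rewrite raddf0.
- by exists (m1 + m2); rewrite linearD.
- have [u uE] := lP _ t n erefl (ltn_ord n).
  by exists (i _ u); rewrite hE.
Qed.

Let exists_enum s : exists e : X -> nat, ~ injects nat {y | class s y} ->
  forall x y, class s x -> class s y -> e x = e y -> x = y.
Proof.
have [inf|[e eI]] := injects_total nat {y | class s y}; first by exists (fun=> 0%N).
exists (fun x => if pselect (class s x) is left sx then e (exist _ x sx) else 0%N).
by move=> _ x y sx sy; case: pselect => // {}sx; case: pselect => // {}sy /eI [].
Qed.

Let enumr s := sval (cid (exists_enum s)).

(** An index outside [big] lies in a countable class, so its sequence and its number within the
    class determine it. *)
Let support_injects : injects {x | I x} (seq K * nat + T)%type.
Proof.
exists (fun x => if pselect (big (sval x)) is left bx then inr (exist _ (sval x) bx)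
  else inl (rep (sval x), enumr (rep (sval x)) (sval x))).
move=> [x Ix] [y Iy] /=.
case: pselect => [bx|nx]; case: pselect => [b_y|ny] // [].
  by move=> e; exact: sval_inj.
move=> rxy e; apply: sval_inj => /=.
have ninf : ~ injects nat {z | class (rep x) z} by move=> inf; case: nx.
by have := svalP (cid (exists_enum (rep x))) ninf x y; apply=> //; rewrite -/(enumr _) e rxy.
Qed.

Let support_generating : generating (fun x : {x | I x} => i (sval x)).
Proof.
have [geni _] := cop; move=> m; elim: {m} (geni m) => [|x v m _ _ IH].
  exact: spanned0.
have [->|v0] := eqVneq v 0; first by rewrite raddf0 add0r.
have Ix : I x by exists v.
exact: (@spannedD _ _ _ _ (fun x : {x | I x} => i (sval x)) setT (exist _ x Ix) v).
Qed.

Lemma injects_big : injects M T.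
Proof.
have seqK : injects (seq K * nat) rho.
  apply: prod_injects => //; apply: injects_trans (seq_injects nat_rho).
  by have [f fI] := R_rho; exists (map f); exact: inj_map.
(* If [T] had size at most [rho], so would the set of nonzero components, and then [M]. *)
have [Trho|rhoT] := injects_total T rho.
  case: large; apply: generating_injects nat_rho _ _ support_generating => //.
  exact: injects_trans support_injects (sum_injects nat_rho seqK Trho).
have natT := injects_trans nat_rho rhoT.
apply: (generating_injects natT _ _ support_generating) => [|x].
  apply: injects_trans support_injects (sum_injects natT _ (injects_refl T)).
  exact: injects_trans seqK rhoT.
exact: injects_trans (V_rho _) rhoT.
Qed.

Lemma exists_large_surjection :
  exists T : cardinal, [/\ injects M T, injects T X &
    exists h : {linear M -> free_mod R T}, forall y, exists x, h x = y].
Proof.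
exists T; split; [exact: injects_big| |exact: large_surjection].
by exists sval; exact: sval_inj.
Qed.

End LargeCoproduct.

(** * Freeness of the large modules and transfer of categoricity *)

Section Conclusion.
Variables (R : pzRingType) (D : modclass R) (prec : strongrel R) (C : modclass R).
Variables (rho lam : cardinal).
Hypothesis DE : forall M, D M <-> perp_inf C M.
Hypothesis precE : forall (M : rmodType R) (A : submodClosed M), prec A <-> ext_prec D A.
Hypothesis aec : is_AEC D prec.
Hypothesis LS : LS_property D prec rho.
Hypothesis nat_rho : injects nat rho.
Hypothesis R_rho : injects R rho.
Hypothesis rho_lam : injects rho lam.
Hypothesis cat_lam : categorical D lam.

Lemma large_free M : D M -> ~ injects M rho -> isomorphic M (free_mod R M).
Proof.
move=> DM large.
have prM := D_only_projective DE precE aec LS nat_rho R_rho rho_lam cat_lam DM.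
have [V [i [cop iV]]] := exists_decomposition DE precE aec LS nat_rho R_rho rho_lam cat_lam DM.
have [x|x [v v0]|T [MT TM [h hS]]] := exists_large_surjection cop nat_rho R_rho _ large.
- by have [] := iV x.
- have [DV Vrho] := iV x.
  have [r rP] := small_generator DE nat_rho R_rho rho_lam cat_lam DV (injects_trans Vrho rho_lam) v0.
  by exists r.
have natM : injects nat M.
  by have [//|Mrho] := injects_total rho M; [exact: injects_trans|case: large].
(* The decomposition is indexed by [M], so [T] injects into [M] as well. *)
have [f fB] : exists f : T -> M, bijective f by apply/ceq_bij/ceq_injects.
have [g [g' _ gK]] := dsum_iso (R^c^o : rmodType R) fB.
pose k : {linear M -> free_mod R M} := g \o (h : {linear M -> dsum T (R^c^o : rmodType R)}).
have kS : forall y, exists x, k x = y.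
  by move=> y; have [x xE] := hS (g' y); exists x; rewrite /= xE.
exact (free_of_free_quotient natM prM kS).
Qed.

End Conclusion.

Theorem theorem1p3 (R : pzRingType) (D : modclass R) (prec : strongrel R)
    (rho : cardinal) (W : cardinal) (le : rel W) (bound : cardinal) :
  AEC_of_roots_of_Ext D prec ->
  is_LS_number D prec rho ->
  is_succ_cardinal (cpow2 rho) le ->
  is_beth le bound ->
  (exists lambda : cardinal, cle bound lambda /\ categorical D lambda) ->
  forall mu : cardinal, cle bound mu -> categorical D mu.
Proof.
move=> [[C DE] precE aec] [[/infinite_injects nat_rho /cleP sym_rho LS] _] leW beth.
move=> [lam [/cleP bound_lam cat_lam]] mu /cleP bound_mu.
have R_rho : injects R rho.
  by apply: injects_trans sym_rho; exists (@SymScale R) => a b [].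
(* The bound exceeds [rho], which puts every module of size [mu] within reach of [large_free]. *)
have large_rho Z : injects bound Z -> ~ injects Z rho.
  by move=> bZ Zrho; apply: (beth_unbounded leW beth); exact: injects_trans Zrho.
have rho_le Z : injects bound Z -> injects rho Z.
  by move=> /large_rho; have [] := injects_total rho Z.
have rho_lam := rho_le _ bound_lam; have rho_mu := rho_le _ bound_mu.
have free_mu M : D M -> ceq M mu -> isomorphic M (free_mod R mu).
  move=> DM /[dup] /ceq_bij[f fB] /ceq_injects[Mmu muM].
  apply: iso_trans (dsum_iso _ fB).
  apply: (large_free DE precE aec LS nat_rho R_rho rho_lam cat_lam DM).
  by move=> Mrho; apply: (large_rho mu bound_mu); exact: injects_trans Mrho.
split.
  exists (free_mod R mu); split; last exact: (free_cardinal nat_rho R_rho rho_lam cat_lam).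
  by apply/DE/projective_perp_inf/projective_free.
by move=> M N DM DN /(free_mu _ DM) Mmu /(free_mu _ DN)/iso_sym; exact: iso_trans.
Qed.
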